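(* Let $\Omega\subset\mathbb{R}^d$ be a bounded domain with Lipschitz boundary and let $s,s'\ge 0$ be integers. Let $\Psi^\dagger: C^s(\overline{\Omega};\mathbb{R}^k)\to C^{s'}(\overline{\Omega};\mathbb{R}^{k'})$ be a continuous operator and let $\mathsf{K}\subset C^s(\overline{\Omega};\mathbb{R}^k)$ be a compact subset. Assume that $\Psi^\dagger(\mathsf{K})$ satisfies the Smoothed Approximation Assumption in $C^{s'}(\Omega;\mathbb{R}^{k'})$ with respect to some sequence of functions $\{\xi_j\}_{j=1}^\infty$, and that $\{\xi_j\}_{j=1}^\infty\subset C^{s'}(\Omega)$. Let $\sigma$ be an activation function satisfying the Activation Assumption with $s_\sigma=s'$. Then for any $\varepsilon>0$ there exists a nonlocal neural operator $\Psi$ with activation $\sigma$ such that $$\sup_{u\in\mathsf{K}}\|\Psi^\dagger(u)-\Psi(u)\|_{C^{s'}(\Omega)}<\varepsilon,$$ where: (i) the final hidden layer (layer $L$) of $\Psi$ contains $\{\xi_j\}_{j=1}^J$ as outer basis elements for some $J$, i.e. $\{\xi_j\}_{j=1}^J\subset\{\phi_{L,m}\}_{m=1}^M$, and the corresponding inner basis functions (those $\psi_{L,m}$ for which $\phi_{L,m}\equiv\xi_j$ for some $j\le J$) each vanish only on a set of Lebesgue measure $0$, are bounded on $\Omega$, and are continuous on $\Omega$; and (ii) an earlier hidden layer of $\Psi$ contains at least one basis function pair $(\psi_{\ell,m},\phi_{\ell,m})=(\eta_1,\eta_2)$ such that $\eta_1\ge0$ on $\Omega$, and each of $\eta_1$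 and $\eta_2$ vanishes only on a set of Lebesgue measure $0$, is bounded on $\Omega$, and is continuous on $\Omega$.
   Context: Norms: $C^{s}(\Omega)$ is the Banach space with norm $\|\eta\|_{C^s(\Omega)}=\sum_{|\alpha|\le s}\sup_{x\in\Omega}|\partial^\alpha\eta(x)|<\infty$. Feedforward neural network with activation $\sigma:\mathbb{R}\to\mathbb{R}$: a map $G:\mathbb{R}^{d_x}\to\mathbb{R}^{d_y}$ of the form $G(x)=A_N\,(L_{N-1}\circ\cdots\circ L_1)(x)+b_N$ with $L_l(z)=\sigma(A_l z+b_l)$, where $A_l$ are matrices and $b_l$ vectors of compatible sizes and $\sigma$ acts componentwise. Nonlocal neural operator (NNO): let $\sigma$ be a non-polynomial $C^\infty$ function on $\mathbb{R}$, acting componentwise on vectors. An NNO with input functions $a:\Omega\to\mathbb{R}^k$ and output functions $\Omega\to\mathbb{R}^{k'}$, with channel width $d_c$, $L$ hidden layers and (per layer) $M$ basis function pairs is a map $\Psi(a)=\mathcal{Q}\circ\mathcal{L}_L\circ\cdots\circ\mathcal{L}_1\circ\mathcal{R}(a)$, where $(\mathcal{R}a)(x)=R(a(x),x)$ with $R:\mathbb{R}^k\times\mathbb{R}^d\to\mathbb{R}^{d_c}$ a feedforward neural network, $(\mathcal{Q}v)(x)=Q(v(x))$ with $Q:\mathbb{R}^{d_c}\to\mathbb{R}^{k'}$ a feedforward neural network, and $$(\mathcal{L}_\ell v)(x)=\sigma\Big(W_\ell v(x)+b_\ell+\sum_{m=1}^M\langle T_{\ell,m}v,\psi_{\ell,m}\rangle\,\phi_{\ell,m}(x)\Big),$$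 with $W_\ell,T_{\ell,m}\in\mathbb{R}^{d_c\times d_c}$, $b_\ell\in\mathbb{R}^{d_c}$, real-valued basis functions $\psi_{\ell,m}$ (inner), $\phi_{\ell,m}$ (outer), and $\langle T_{\ell,m}v,\psi_{\ell,m}\rangle=T_{\ell,m}\int_\Omega v(y)\psi_{\ell,m}(y)\,dy\in\mathbb{R}^{d_c}$ (componentwise $L^2(\Omega)$ inner product). The numbers $d_c,L,M$ are free. Activation Assumption (with parameter $s_\sigma\ge 0$): $\sigma$ is non-polynomial and $C^\infty$, $\sigma(0)=0$, and for every finite dimension $n$, every $\epsilon>0$ and every closed ball $\mathcal{K}\subset\mathbb{R}^n$ there is a feedforward neural network $G:\mathbb{R}^n\to\mathbb{R}^n$ with activation $\sigma$ such that $G(0)=0$ and $\|G-\mathrm{id}\|_{C^{s_\sigma}(\mathcal{K})}<\epsilon$. Smoothed Approximation Assumption: let $\Omega\subset\mathbb{R}^d$ be a bounded set and $\mathcal{B}(\Omega)$ a Banach space of functions on $\Omega$ continuously embedded in $L^1(\Omega)$. A compact subset $\mathsf{K}'\subset\mathcal{B}(\Omega)$ satisfies the assumption in $\mathcal{B}(\Omega)$ with respect to functions $\{\eta_j\}_{j=1}^\infty$ if there exist a set $B\subset\mathbb{R}^d$ with $B\supseteq\Omega$ on which all $\eta_j$ are defined, and a family of linear maps $\{f_\delta\}_{\delta>0}$, $f_\delta:\mathcal{B}(\Omega)\to\mathcal{B}(\Omega)$, with $f_\delta(w)$ also defined on $B$, such that: (S1) $\lim_{\delta\to0}\sup_{w\in\mathsf{K}'}\|f_\delta(w)-w\|_{\mathcal{B}(\Omega)}=0$;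 (S2) for each $\delta>0$, $\lim_{J\to\infty}\sup_{w\in\mathsf{K}'}\|f_\delta(w)-\sum_{j=1}^J\langle f_\delta(w),\eta_j\rangle_{L^2(B)}\eta_j\|_{\mathcal{B}(\Omega)}=0$; (S3) for each $\delta>0$ and $j\in\mathbb{N}$, $w\mapsto\langle f_\delta(w),\eta_j\rangle_{L^2(B)}$ is a continuous functional on $\mathcal{B}(\Omega)$. For $\mathbb{R}^{k'}$-valued function spaces the $\eta_j$ are real-valued and the inner products are taken componentwise (so they are $\mathbb{R}^{k'}$-valued). *)

(* Defs.v *)
From HB Require Import structures.
From mathcomp Require Import all_boot all_order all_algebra.
From mathcomp Require Import all_classical all_reals all_analysis.

Set Implicit Arguments.
Unset Strict Implicit.
Unset Printing Implicit Defensive.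

Import Order.TTheory GRing.Theory Num.Theory.
Import numFieldNormedType.Exports.

Local Open Scope classical_set_scope.
Local Open Scope ring_scope.

(* Supremum over [A] of a nonnegative quantity. Adjoining 0 makes the supremum
   over the empty set equal to 0 instead of -oo. *)
Definition nnsup (R : realType) (T : Type) (A : set T) (g : T -> \bar R) :
  \bar R := ereal_sup (0%E |` [set g x | x in A]).

Section lebesgue_measure_Rd.
Variable R : realType.
Local Notation tR n := (n.-tuple (measurableTypeR R)).

Definition tuple_cons n (p : measurableTypeR R * tR n) : tR n.+1 :=
  [tuple of p.1 :: p.2].

Definition tuple_uncons n (t : tR n.+1) : measurableTypeR R * tR n :=
  (thead t, [tuple of behead t]).

Lemma measurable_tuple_cons n : measurable_fun setT (@tuple_cons n).
Proof. exact: measurable_cons. Qed.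

Lemma measurable_tuple_uncons n : measurable_fun setT (@tuple_uncons n).
Proof.
apply: measurable_fun_pair; first exact: measurable_tnth.
exact: measurable_behead.
Qed.

Lemma tuple_consK n : cancel (@tuple_cons n) (@tuple_uncons n).
Proof. by case=> x t; congr pair; apply: val_inj. Qed.

Section step.
Variables (n : nat) (mu : {sigma_finite_measure set (tR n) -> \bar R}).

Definition lebesgue_cons : set (tR n.+1) -> \bar R :=
  pushforward (@lebesgue_measure R \x mu)%E (@tuple_cons n).

Let measurable_preimage_cons A : measurable A ->
  measurable (@tuple_cons n @^-1` A).
Proof.
by move=> mA; rewrite -[X in measurable X]setTI; exact: measurable_tuple_cons.
Qed.

Let lebesgue_cons0 : lebesgue_cons set0 = 0%E.
Proof. by rewrite /lebesgue_cons /pushforward preimage_set0 measure0. Qed.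

Let lebesgue_cons_ge0 A : (0 <= lebesgue_cons A)%E.
Proof. by rewrite /lebesgue_cons /pushforward; exact: measure_ge0. Qed.

Let lebesgue_cons_sigma_additive : semi_sigma_additive lebesgue_cons.
Proof.
move=> F mF tF mUF; rewrite /lebesgue_cons /pushforward preimage_bigcup.
apply: measure_semi_sigma_additive.
- by move=> i; exact: measurable_preimage_cons.
- apply/trivIsetP => /= i j _ _ ij; rewrite -preimage_setI.
  by move/trivIsetP : tF => /(_ _ _ _ _ ij) ->//; rewrite preimage_set0.
- by rewrite -preimage_bigcup; exact: measurable_preimage_cons.
Qed.

HB.instance Definition _ := isMeasure.Build _ _ _ lebesgue_cons
  lebesgue_cons0 lebesgue_cons_ge0 lebesgue_cons_sigma_additive.

Let lebesgue_cons_sigma_finite : sigma_finite setT lebesgue_cons.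
Proof.
have /sigma_finiteP[F [TF ndF Foo]] := sigma_finiteT (@lebesgue_measure R).
have /sigma_finiteP[G [TG ndG Goo]] := sigma_finiteT mu.
exists (fun i => @tuple_uncons n @^-1` (F i `*` G i)).
  rewrite -preimage_bigcup -[LHS](preimage_setT (@tuple_uncons n)).
  congr (_ @^-1` _); rewrite -setXTT TF TG predeqE => -[x y]; split.
    move=> [/= [i _ Fix] [j _ Gjy]]; exists (maxn i j) => //; split.
    - by move: x Fix; exact/subsetPset/ndF/leq_maxl.
    - by move: y Gjy; exact/subsetPset/ndG/leq_maxr.
  by move=> [i _ []/= ? ?]; split; exists i.
move=> i; have [mF Fi] := Foo i; have [mG Gi] := Goo i; split.
  rewrite -[X in measurable X]setTI; apply: measurable_tuple_uncons => //.
  exact: measurableX.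
rewrite /lebesgue_cons /pushforward -comp_preimage.
rewrite (_ : _ \o _ = id) ?preimage_id; last exact/funext/tuple_consK.
by rewrite product_measure1E// lte_mul_pinfty// ge0_fin_numE.
Qed.

HB.instance Definition _ := Measure_isSigmaFinite.Build _ _ _ lebesgue_cons
  lebesgue_cons_sigma_finite.

End step.

Fixpoint lebesgue_tuple n : {sigma_finite_measure set (tR n) -> \bar R} :=
  match n with
  | 0 => [the {sigma_finite_measure set (tR 0) -> \bar R} of
           dirac ([tuple] : tR 0)]
  | n'.+1 => [the {sigma_finite_measure set (tR n'.+1) -> \bar R} of
               lebesgue_cons (lebesgue_tuple n')]
  end.

Definition tuple_of_cV d (x : 'cV[R]_d) : tR d := [tuple x i 0 | i < d].

Definition lebesgue_outer d (A : set 'cV[R]_d) : \bar R :=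
  ((lebesgue_tuple d)^*)%mu [set tuple_of_cV x | x in A].

Section outer.
Variable d : nat.

Let lebesgue_outer0 : lebesgue_outer (@set0 'cV[R]_d) = 0%E.
Proof. by rewrite /lebesgue_outer image_set0 outer_measure0. Qed.

Let lebesgue_outer_ge0 (A : set 'cV[R]_d) : (0 <= lebesgue_outer A)%E.
Proof. exact: outer_measure_ge0. Qed.

Let le_lebesgue_outer :
  {homo @lebesgue_outer d : A B / A `<=` B >-> (A <= B)%E}.
Proof. by move=> A B AB; apply: le_outer_measure; exact: image_subset. Qed.

Let lebesgue_outer_sigma_subadditive : sigma_subadditive (@lebesgue_outer d).
Proof.
move=> F; rewrite /lebesgue_outer image_bigcup.
exact: outer_measure_sigma_subadditive.
Qed.

HB.instance Definition _ := isOuterMeasure.Build R 'cV[R]_d (@lebesgue_outer d)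
  lebesgue_outer0 lebesgue_outer_ge0 le_lebesgue_outer
  lebesgue_outer_sigma_subadditive.
End outer.

(* [R^d] with its sigma-algebra of Lebesgue measurable sets (Caratheodory), and
   the complete Lebesgue measure on it. *)
Definition lebesgue_type d := caratheodory_type (@lebesgue_outer d).
HB.instance Definition _ d := Measurable.on (lebesgue_type d).

Section lebesgue.
Variable d : nat.

Definition lebesgue : set (lebesgue_type d) -> \bar R := @lebesgue_outer d.

HB.instance Definition _ := isMeasure.Build _ _ _ lebesgue
  (caratheodory_measure0 (@lebesgue_outer d))
  (@caratheodory_measure_ge0 _ _ (@lebesgue_outer d))
  (@caratheodory_measure_sigma_additive _ _ (@lebesgue_outer d)).

End lebesgue.

End lebesgue_measure_Rd.
Arguments lebesgue {R} d.

Section Cs_spaces.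
Variables (R : realType) (d : nat).

Section partial.
Variable W : normedModType R.
Implicit Types (f : 'cV[R]_d -> W) (s : nat) (A : set 'cV[R]_d).

Definition partial (i : 'I_d) f : 'cV[R]_d -> W := 'D_(delta_mx i 0) f.

Definition partials (l : seq 'I_d) f := foldr partial f l.

(* Multi-indices with entries at most [s]; those with [|alpha| <= s] are
   selected by [order_le]. *)
Definition multi_index s := {ffun 'I_d -> 'I_s.+1}.

Definition order_le s (alpha : multi_index s) : bool :=
  (\sum_i alpha i <= s)%N.

Definition dmulti s (alpha : multi_index s) f : 'cV[R]_d -> W :=
  partials (flatten [seq nseq (alpha i) i | i <- enum 'I_d]) f.

(* [f] is [s] times continuously differentiable at the points of [A]. The
   derivatives are those of [f] as a function on [R^d], so [A] is meant to be
   open, or [f] to be smooth around [A]. *)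
Definition Cs_at s A f := forall l : seq 'I_d, (size l <= s)%N ->
  (forall x, A x -> {for x, continuous (partials l f)}) /\
  ((size l < s)%N -> forall i x, A x ->
     derivable (partials l f) x (delta_mx i 0)).

(* Values in [R^n] are measured in the norm of the library, which is the
   maximum norm. The value is +oo when [f] is not in [C^s(A)]. *)
Definition Cs_norm s A f : \bar R :=
  if `[< Cs_at s A f >] then
    (\sum_(alpha : multi_index s | order_le alpha)
       nnsup A (fun x => `|dmulti alpha f x|%:E))%E
  else +oo%E.

Lemma order_leP s (alpha : multi_index s) : order_le alpha ->
  (size (flatten [seq nseq (alpha i) i | i <- enum 'I_d]) <= s)%N.
Proof.
rewrite size_flatten /shape -map_comp sumnE big_map big_enum /order_le /=.
move=> h; apply: leq_trans h; rewrite (eq_bigr (fun i => (alpha i : nat))) //.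
by move=> i _; rewrite size_nseq.
Qed.

Section openset.
Variables (A : set 'cV[R]_d) (oA : open A) (s : nat).

Lemma partials_linear (a : R) f g l x :
  Cs_at s A f -> Cs_at s A g -> (size l <= s)%N -> A x ->
  partials l (a *: f + g) x = a *: partials l f x + partials l g x.
Proof.
move=> sf sg; elim: l x => [|i l IH] x sl Ax //=.
have dl := (sf l (ltnW sl)).2 sl i x Ax; have gl := (sg l (ltnW sl)).2 sl i x Ax.
rewrite /partial -(deriveZ _ dl) -(deriveD (derivableZ dl) gl).
apply: near_eq_derive; near=> y; apply: IH; first exact: ltnW.
by near: y; exact: open_nbhs_nbhs.
Unshelve. all: by end_near. Qed.

Lemma Cs_at_linear (a : R) f g :
  Cs_at s A f -> Cs_at s A g -> Cs_at s A (a *: f + g).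
Proof.
move=> sf sg l sl; have eqn x : A x -> {near x,
    (fun y => a *: partials l f y + partials l g y) =1 partials l (a *: f + g)}.
  move=> Ax; near=> y; apply/esym/partials_linear => //.
  by near: y; exact: open_nbhs_nbhs.
split=> [x Ax|sl' i x Ax].
  rewrite /prop_for /continuous_at -(nbhs_singleton (eqn _ Ax)).
  apply: cvg_trans (near_eq_cvg (eqn _ Ax)) _.
  by apply: cvgD; [apply: cvgZr; exact: (sf l sl).1 | exact: (sg l sl).1].
apply: near_eq_derivable (eqn _ Ax) _.
apply: (@derivableD _ _ _ (a \*: partials l f)).
  exact: (derivableZ ((sf l sl).2 sl' i x Ax)).
exact: (sg l sl).2.
Unshelve. all: by end_near. Qed.

End openset.

Lemma nnsup_ge0 T (D : set T) (g : T -> \bar R) : (0 <= nnsup D g)%E.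
Proof. by apply: ereal_sup_ubound; left. Qed.

Lemma nnsup_ub T (D : set T) (g : T -> \bar R) x :
  D x -> (g x <= nnsup D g)%E.
Proof. by move=> Dx; apply: ereal_sup_ubound; right; exists x. Qed.

Lemma nnsup_le T (D : set T) (g : T -> \bar R) (M : \bar R) :
  (0 <= M)%E -> (forall x, D x -> (g x <= M)%E) -> (nnsup D g <= M)%E.
Proof. by move=> M0 gM; apply: ge_ereal_sup => _ [->//|[x Dx <-]]; exact: gM. Qed.

Lemma Cs_norm_ge0 s A f : (0 <= Cs_norm s A f)%E.
Proof.
rewrite /Cs_norm; case: ifP => // _; apply: sume_ge0 => alpha _.
exact: nnsup_ge0.
Qed.

Lemma Cs_norm_fin s A f : (Cs_norm s A f < +oo)%E -> Cs_at s A f.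
Proof. by rewrite /Cs_norm; case: asboolP. Qed.

Lemma Cs_norm_tri (A : set 'cV[R]_d) (oA : open A) s f g :
  (Cs_norm s A f < +oo)%E -> (Cs_norm s A g < +oo)%E ->
  (Cs_norm s A (f + g)%R <= Cs_norm s A f + Cs_norm s A g)%E.
Proof.
move=> /Cs_norm_fin sf /Cs_norm_fin sg; have := Cs_at_linear oA 1 sf sg.
rewrite scale1r /Cs_norm => sfg; do 3 rewrite asboolT//.
rewrite -big_split /=; apply: lee_sum => alpha /order_leP sa.
apply: nnsup_le => [|x Ax]; first by rewrite adde_ge0// nnsup_ge0.
have := @partials_linear A oA s 1 _ _ _ x sf sg sa Ax; rewrite !scale1r.
rewrite /dmulti => ->; apply: (@le_trans _ _
  (`|partials _ f x|%:E + `|partials _ g x|%:E)%E).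
  by rewrite -EFinD lee_fin; exact: ler_normD.
by apply: leeD; [exact: (@nnsup_ub _ A (fun y => `|partials _ f y|%:E))|
  exact: (@nnsup_ub _ A (fun y => `|partials _ g y|%:E))].
Qed.

Lemma partials0 l : partials l (0 : 'cV[R]_d -> W) = 0.
Proof. by elim: l => [//|i l /= ->]; apply/funext => x; exact: derive_cst. Qed.

Lemma Cs_at0 s A : Cs_at s A (0 : 'cV[R]_d -> W).
Proof.
move=> l sl; rewrite partials0.
by split=> [x _|_ i x _]; [exact: cst_continuous|exact: (@derivable_cst _ _ _ 0)].
Qed.

Lemma Cs_norm0 s A : Cs_norm s A (0 : 'cV[R]_d -> W) = 0%E.
Proof.
rewrite /Cs_norm asboolT; last exact: Cs_at0.
apply: big1 => alpha _; apply/eqP; rewrite eq_le nnsup_ge0 andbT.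
by apply: nnsup_le => // x _; rewrite /dmulti partials0 normr0.
Qed.

Lemma Cs_normZ_le (A : set 'cV[R]_d) (oA : open A) s (a : R) f :
  (Cs_norm s A f < +oo)%E ->
  (Cs_norm s A (a *: f)%R <= `|a|%:E * Cs_norm s A f)%E.
Proof.
move=> /Cs_norm_fin sf; have s0 := @Cs_at0 s A.
have := Cs_at_linear oA a sf s0; rewrite addr0 /Cs_norm => sa.
do 2 rewrite asboolT//; rewrite ge0_sume_distrr; last by move=> *; exact: nnsup_ge0.
apply: lee_sum => alpha /order_leP sal.
apply: nnsup_le => [|x Ax]; first by rewrite mule_ge0// nnsup_ge0.
have := @partials_linear A oA s a _ _ _ x sf s0 sal Ax.
rewrite addr0 /dmulti => ->.
rewrite partials0 addr0 normrZ EFinM; apply: lee_wpmul2l => //.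
exact: (@nnsup_ub _ A (fun y => `|partials _ f y|%:E)).
Qed.

Lemma Cs_norm_eq0 (A : set 'cV[R]_d) s f :
  Cs_norm s A f = 0%E -> forall x, A x -> f x = 0.
Proof.
rewrite /Cs_norm; case: ifP => // _ f0 x Ax.
pose a0 : multi_index s := [ffun=> ord0].
have a0s : order_le a0 by rewrite /order_le big1// => i _; rewrite ffunE.
have f00 : (nnsup A (fun x => `|dmulti a0 f x|%:E) <= 0)%E.
  rewrite -f0 (bigD1 a0)//= leeDl// sume_ge0// => *; exact: nnsup_ge0.
have := le_trans (@nnsup_ub _ A (fun x => `|dmulti a0 f x|%:E) x Ax) f00.
rewrite lee_fin normr_le0 /dmulti.
have -> : flatten [seq nseq (a0 i) i | i <- enum 'I_d] = [::].
  by elim: (enum 'I_d) => //= i l ->; rewrite ffunE.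
by move/eqP.
Qed.

End partial.
End Cs_spaces.

Section Cs_type.
Variables (R : realType) (d : nat) (A : set 'cV[R]_d) (oA : open A) (s : nat).
Variable W : normedModType R.

Definition Cs_pred of open A : {pred 'cV[R]_d -> W} :=
  [pred f | `[< (Cs_norm s A f < +oo)%E /\ forall x, ~ A x -> f x = 0 >]].

(* The space [C^s(A; W)], [A] open. A function on [A] is represented by its
   extension by 0 to [R^d]; only its values on [A] matter. *)
Record Cs_space := CsSpace { Cs_fun :> 'cV[R]_d -> W; _ : Cs_fun \in Cs_pred oA }.

HB.instance Definition _ := [isSub for Cs_fun].
HB.instance Definition _ := [Choice of Cs_space by <:].

Let Cs_submod : submod_closed (Cs_pred oA).
Proof.
split=> [|a f g].
  by rewrite inE; split=> // ; rewrite Cs_norm0.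
rewrite !inE => -[f1 f2] [g1 g2]; split.
  have f3 : (Cs_norm s A (a *: f)%R < +oo)%E.
    apply: le_lt_trans (Cs_normZ_le oA a f1) _.
    by rewrite lte_mul_pinfty// ge0_fin_numE// Cs_norm_ge0.
  by apply: le_lt_trans (Cs_norm_tri oA f3 g1) _; rewrite lte_add_pinfty.
by move=> x nAx; rewrite !fctE f2// g2// scaler0 addr0.
Qed.

HB.instance Definition _ :=
  GRing.isSubmodClosed.Build R ('cV[R]_d -> W) (Cs_pred oA) Cs_submod.
HB.instance Definition _ := [SubChoice_isSubLmodule of Cs_space by <:].

Lemma Cs_spaceP (f : Cs_space) :
  (Cs_norm s A f < +oo)%E /\ forall x, ~ A x -> f x = 0.
Proof. by have := valP f; rewrite inE. Qed.

Lemma Cs_space_fin (f : Cs_space) : Cs_norm s A f \is a fin_num.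
Proof. by rewrite ge0_fin_numE ?Cs_norm_ge0//; exact: (Cs_spaceP f).1. Qed.

Definition Cs_space_norm (f : Cs_space) : R := fine (Cs_norm s A f).

Let normD f g : Cs_space_norm (f + g) <= Cs_space_norm f + Cs_space_norm g.
Proof.
rewrite -lee_fin EFinD /Cs_space_norm !fineK ?Cs_space_fin//.
exact: (Cs_norm_tri oA (Cs_spaceP f).1 (Cs_spaceP g).1).
Qed.

Let normZ_le (a : R) f : Cs_space_norm (a *: f) <= `|a| * Cs_space_norm f.
Proof.
rewrite -lee_fin EFinM /Cs_space_norm !fineK ?Cs_space_fin//.
exact: (Cs_normZ_le oA a (Cs_spaceP f).1).
Qed.

Let normZ (a : R) f : Cs_space_norm (a *: f) = `|a| * Cs_space_norm f.
Proof.
apply/eqP; rewrite eq_le normZ_le /=; have [->|a0] := eqVneq a 0.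
  by rewrite normr0 mul0r -lee_fin /Cs_space_norm fineK ?Cs_space_fin// Cs_norm_ge0.
rewrite -ler_pdivlMl ?normr_gt0// -normfV.
by apply: le_trans (normZ_le a^-1 (a *: f)); rewrite scalerA mulVf// scale1r.
Qed.

Let norm_eq0 f : Cs_space_norm f = 0 -> f = 0.
Proof.
move=> f0; apply/val_inj/funext => x /=.
have [Ax|nAx] := pselect (A x); last exact: (Cs_spaceP f).2.
apply: (@Cs_norm_eq0 _ _ _ A s) => //.
by rewrite -(fineK (Cs_space_fin f)) -/(Cs_space_norm f) f0.
Qed.

HB.instance Definition _ :=
  Lmodule_isNormed.Build R Cs_space normD normZ norm_eq0.

(* The elements of [C^s(A; W)] all of whose derivatives of order at most [s]
   extend continuously to the closure of [A]: the closed subspace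
   [C^s(closure A; W)], with the same norm. *)
Definition Cs_closure : set Cs_space :=
  [set f | forall alpha : multi_index d s, order_le alpha ->
    exists g : 'cV[R]_d -> W, {within closure A, continuous g} /\
      {in A, g =1 dmulti alpha f}].

End Cs_type.

Section domains.
Variables (R : realType) (d : nat).
Implicit Type Omega : set 'cV[R]_d.

(* Near every boundary point, after a rigid motion and up to the choice of the
   coordinate axis [i], [Omega] is the strict epigraph of a Lipschitz function
   of the other coordinates. *)
Definition lipschitz_boundary Omega : Prop :=
  forall x, (closure Omega `\` Omega°) x ->
  exists (U : set 'cV[R]_d) (Q : 'M[R]_d) (i : 'I_d) (gamma : 'cV[R]_d.-1 -> R),
    [/\ nbhs x U, Q *m Q^T = 1%:M, lipschitz (gamma : _ -> R^o) &
        forall y, U y -> Omega y <->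
          gamma (row' i (Q *m (y - x))) < (Q *m (y - x)) i 0].

(* [\int_B v(y) psi(y) dy], componentwise. *)
Definition L2_inner k (B : set 'cV[R]_d) (v : 'cV[R]_d -> 'cV[R]_k)
    (psi : 'cV[R]_d -> R) : 'cV[R]_k :=
  \col_i Rintegral (lebesgue d) B (fun y => v y i 0 * psi y).

Definition L2_inner_defined k (B : set 'cV[R]_d) (v : 'cV[R]_d -> 'cV[R]_k)
    (psi : 'cV[R]_d -> R) : Prop :=
  forall i, (lebesgue d).-integrable B (fun y => (v y i 0 * psi y)%:E).

(* The assumption for the space [C^s(Omega; R^k)]; [f] is the family
   [f_delta] and [fB delta w] is [f_delta(w)] as a function on [B]. *)
Definition smoothed_approximation Omega (oO : open Omega) s k
    (K : set (Cs_space oO s 'cV[R]_k)) (eta : nat -> 'cV[R]_d -> R) : Prop :=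
  exists (B : set 'cV[R]_d)
         (f : R -> Cs_space oO s 'cV[R]_k -> Cs_space oO s 'cV[R]_k)
         (fB : R -> Cs_space oO s 'cV[R]_k -> 'cV[R]_d -> 'cV[R]_k),
  [/\ [/\ Omega `<=` B, measurable (B : set (lebesgue_type R d)),
          forall delta, 0 < delta -> linear (f delta),
          forall delta w, 0 < delta -> {in Omega, fB delta w =1 f delta w} &
          forall delta w j, 0 < delta ->
            L2_inner_defined B (fB delta w) (eta j)],
      nnsup K (fun w => `|f delta w - w|%:E) @[delta --> 0^'+] --> 0%E,
      forall delta, 0 < delta ->
        nnsup K (fun w => Cs_norm s Omega (fun x => f delta w x -
            \sum_(j < J) eta j x *: L2_inner B (fB delta w) (eta j)))
          @[J --> \oo] --> 0%E &
      forall delta j, 0 < delta ->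
        continuous (fun w => L2_inner B (fB delta w) (eta j))].

Definition vanishes_only_on_null Omega (f : 'cV[R]_d -> R) : Prop :=
  (lebesgue d).-negligible (Omega `&` [set x | f x = 0]).

Definition admissible_basis Omega (f : 'cV[R]_d -> R) : Prop :=
  [/\ vanishes_only_on_null Omega f,
      [bounded (f x : R^o) | x in Omega] & {within Omega, continuous f}].

End domains.

Section networks.
Variables (R : realType) (sigma : R -> R).

(* A network has at least one hidden layer: with none allowed, the identity
   would be a network and [activation_assumption] would not constrain networks. *)
Inductive hidden_layers m : forall p, ('cV[R]_m -> 'cV[R]_p) -> Prop :=
| first_hidden p (A : 'M[R]_(p, m)) (b : 'cV[R]_p) :
    hidden_layers (fun x => map_mx sigma (A *m x + b))
| next_hidden p q (A : 'M[R]_(q, p)) (b : 'cV[R]_q) H :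
    hidden_layers H -> hidden_layers (fun x => map_mx sigma (A *m H x + b)).

Definition feedforward m n (G : 'cV[R]_m -> 'cV[R]_n) : Prop :=
  exists p (H : 'cV[R]_m -> 'cV[R]_p) (A : 'M[R]_(n, p)) (b : 'cV[R]_n),
    hidden_layers H /\ forall x, G x = A *m H x + b.

(* Euclidean ball, whereas [closed_ball] is a ball of the maximum norm. *)
Definition closed_ball2 n (c : 'cV[R]_n) (r : R) : set 'cV[R]_n :=
  [set x | \sum_i (x i 0 - c i 0) ^+ 2 <= r ^+ 2].

Definition non_polynomial : Prop := ~ exists p : {poly R}, sigma =1 horner p.

Definition smooth : Prop := forall n x, derivable (derive1n n sigma : R -> R^o) x 1.

Definition activation_assumption (s : nat) : Prop :=
  [/\ non_polynomial, smooth, sigma 0 = 0 &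
   forall n (eps : R) (c : 'cV[R]_n) (r : R), 0 < eps -> 0 < r ->
     exists G : 'cV[R]_n -> 'cV[R]_n, [/\ feedforward G, G 0 = 0 &
       (Cs_norm s (closed_ball2 c r) (fun x => G x - x)%R < eps%:E)%E]].

Section nno.
Variables (d k k' : nat) (Omega : set 'cV[R]_d).

Record nno_layer dc M := NnoLayer {
  nno_W : 'M[R]_dc;
  nno_b : 'cV[R]_dc;
  nno_T : 'I_M -> 'M[R]_dc;
  nno_psi : 'I_M -> 'cV[R]_d -> R;
  nno_phi : 'I_M -> 'cV[R]_d -> R }.

Definition layer_map dc M (l : nno_layer dc M) (v : 'cV[R]_d -> 'cV[R]_dc) :
    'cV[R]_d -> 'cV[R]_dc :=
  fun x => map_mx sigma (nno_W l *m v x + nno_b l +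
    \sum_m nno_phi l m x *: (nno_T l m *m L2_inner Omega v (nno_psi l m))).

(* [nno_layers l] is the layer of number [l.+1]; the values for
   [nno_depth <= l] are unused. *)
Record nno := Nno {
  nno_width : nat;
  nno_depth : nat;
  nno_M : nat;
  nno_lift : 'cV[R]_(k + d) -> 'cV[R]_nno_width;
  nno_proj : 'cV[R]_nno_width -> 'cV[R]_k';
  nno_layers : nat -> nno_layer nno_width nno_M;
  nno_liftP : feedforward nno_lift;
  nno_projP : feedforward nno_proj }.

Fixpoint nno_hidden (Psi : nno) (a : 'cV[R]_d -> 'cV[R]_k) (l : nat) :
    'cV[R]_d -> 'cV[R]_(nno_width Psi) :=
  match l with
  | 0 => fun x => @nno_lift Psi (col_mx (a x) x)
  | l'.+1 => layer_map (@nno_layers Psi l') (nno_hidden Psi a l')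
  end.

Definition nno_eval (Psi : nno) (a : 'cV[R]_d -> 'cV[R]_k) :
    'cV[R]_d -> 'cV[R]_k' :=
  fun x => @nno_proj Psi (nno_hidden Psi a (nno_depth Psi) x).

(* All the integrals in the definition of [Psi(a)] exist. *)
Definition nno_defined (Psi : nno) (a : 'cV[R]_d -> 'cV[R]_k) : Prop :=
  forall l m, (l < nno_depth Psi)%N ->
    L2_inner_defined Omega (nno_hidden Psi a l) (nno_psi (nno_layers Psi l) m).

End nno.
End networks.

(* Main.v *)
Require Import Defs.
From HB Require Import structures.
From mathcomp Require Import all_boot all_order all_algebra.
From mathcomp Require Import all_classical all_reals all_analysis.
From mathcomp Require Import measurable_realfun ring lra.

Set Implicit Arguments.
Unset Strict Implicit.
Unset Printing Implicit Defensive.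

Import Order.TTheory GRing.Theory Num.Theory.
Import numFieldNormedType.Exports.

Local Open Scope classical_set_scope.
Local Open Scope ring_scope.

(** The theorem is true for the following reason.

    Smoothing.  By the smoothed approximation assumption, PsiD u is, uniformly
    for u in K, within 2 eps / 5 in C^s' of a finite sum
    \sum_(j < J) xi j *: c j u whose coefficients, the inner products of a
    smoothing of PsiD u with the xi j, are continuous functionals on K.
    It remains to approximate finitely many continuous functionals
    on K, and then to carry the resulting combination z of the xi j through
    the last activation and the projection.

    Functionals.  A feature is a functional u |-> \sum_i \int_Omega u_i psi_i
    with psi bounded and continuous on Omega.  Two distinct elements u, v of C^s
    are separated by the feature of psi := u - v, because a nonzero continuous
    function has a positive square integral (lebesgue_open_gt0,
    Rintegral_sqr_eq0).  Shallow networks \sum w sigma(l u + b) in features l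
    are dense in C(K) (shallow_dense): a derivative of such a network in the
    direction of another feature is a uniform limit of difference quotients, so
    that the closure contains every product of n features times
    sigma^(n)(l u + b); as sigma is not a polynomial, sigma^(n) does not vanish
    identically, and l = 0 gives every monomial in the features; Stone-Weierstrass
    concludes.

    Near-identities.  If sigma'(c) != 0 then
    g t := (sigma (h t + c) - sigma c) / (h sigma'(c)) tends to t with all its
    derivatives, uniformly on bounded sets, as h -> 0 (near_identity).  Acting
    coordinate by coordinate with this one-variable g reduces the C^s'
    estimate of z - g (g z) to the one-variable chain rule
    (double_near_identity).  Along a sorted list of directions the product and
    chain rules only produce partial derivatives along its subsequences, which
    are sorted too; these are the ones that Cs_norm measures.

    Operator.  Two hidden layers are enough (operator, operatorE).  The lift is
    g acting on the values of u.  The first layer integrates against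
    the psi and produces the neurons, which are constant in x.  The second layer
    has the constant 1 as every inner basis function and the xi j among its
    outer ones, and outputs sigma (b z + c), the inner half of the first of two
    copies of g; the projection completes this copy and applies the second one,
    since a network has a hidden layer of its own.  A pair of constant
    functions 1 with weight 0 in the first layer is the pair of nonvanishing
    basis functions asked of a layer before the last. *)

(** * Stone-Weierstrass on a compact subset *)

(** A compactness argument without covers: if P failed on K, the sets whose
    complement in K satisfies P would form a proper filter containing K; but P
    holds near a cluster point x of that filter, so the filter also contains
    the complement of a neighborhood of x. *)
Lemma compact_local_induction (U : topologicalType) (K : set U)
    (P : set U -> Prop) : compact K -> P set0 ->
  (forall A B, A `<=` B -> P B -> P A) ->
  (forall A B, P A -> P B -> P (A `|` B)) ->
  (forall x, K x -> exists2 N, nbhs x N & P (N `&` K)) ->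
  P K.
Proof.
move=> cK P0 Pmono PU Ploc; apply: contrapT => nPK.
pose F : set (set U) := fun A => P (K `\` A).
have FF : ProperFilter F.
  apply: Build_ProperFilter.
    by rewrite /F setD0.
  split=> [|A B FA FB|A B AB FA]; rewrite /F.
  - by rewrite setDT.
  - by rewrite setDIr; exact: PU.
  - by apply: Pmono FA; exact: setDS.
have [|x [Kx clx]] := cK F FF; first by rewrite /F setDv.
have [N Nx PN] := Ploc _ Kx.
have [|y [Fy Ny]] := clx (~` N) N _ Nx; last by [].
by rewrite /F setDE setCK setIC.
Qed.


Section uniform_closure.
Context (R : realType) (U : Type) (K : set U).
Implicit Types (f g : U -> R) (A : set (U -> R)).

Definition uniform_closure A : set (U -> R) :=
  [set f | forall e : R, 0 < e ->
    exists2 g, A g & forall u, K u -> `|f u - g u| <= e].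

Definition linear_class A :=
  A (fun=> 0) /\ forall a f g, A f -> A g -> A (fun u => a * f u + g u).

Lemma sub_uniform_closure A : A `<=` uniform_closure A.
Proof.
by move=> f Af e e0; exists f => // u _; rewrite subrr normr0 ltW.
Qed.

Lemma uniform_closure_sub A B : A `<=` uniform_closure B ->
  uniform_closure A `<=` uniform_closure B.
Proof.
move=> AB f Af e e0; have e20 : 0 < e / 2 by rewrite divr_gt0.
have [g Ag fg] := Af _ e20; have [h Bh gh] := AB _ Ag _ e20.
exists h => // u Ku.
by rewrite [e]splitr (le_trans (ler_distD (g u) _ _))// lerD ?fg ?gh.
Qed.

Lemma uniform_closure_linear A : linear_class A ->
  linear_class (uniform_closure A).
Proof.
move=> [A0 AD]; split=> [|a f g Af Ag e e0]; first exact: sub_uniform_closure.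
have a0 : 0 < `|a| + 1 by rewrite ltr_wpDl.
have [f' Af' ff'] := Af (e / 2 / (`|a| + 1)) ltac:(by rewrite !divr_gt0).
have [g' Ag' gg'] := Ag (e / 2) ltac:(by rewrite divr_gt0).
exists (fun u => a * f' u + g' u); first exact: AD.
move=> u Ku; rewrite opprD addrACA -mulrBr [leRHS]splitr.
rewrite (le_trans (ler_normD _ _))// lerD ?gg'// normrM.
apply: (@le_trans _ _ ((`|a| + 1) * `|f' u - f u|)).
  by rewrite distrC ler_wpM2r// lerDl.
by rewrite -ler_pdivlMl// mulrC distrC ff'.
Qed.

End uniform_closure.

Section stone_weierstrass.
Context (R : realType) (U : topologicalType) (K : set U).
Hypothesis cK : compact K.
Implicit Types f g : U -> R.

Lemma within_near f x e : {within K, continuous f} -> K x -> 0 < e ->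
  \forall y \near x, K y -> `|f x - f y| < e.
Proof.
move=> /subspace_continuousP cf Kx e0.
by have /cvgrPdist_lt/(_ _ e0) := cf _ Kx; rewrite near_withinE.
Qed.

Lemma compact_within_bounded f : {within K, continuous f} ->
  exists2 M : R, 0 < M & forall x, K x -> `|f x| <= M.
Proof.
move=> cf; pose P (S : set U) := exists2 M : R, 0 < M & forall x, S x -> `|f x| <= M.
apply: (@compact_local_induction _ K P) => //.
- by exists 1.
- by move=> A B AB [M M0 MB]; exists M => // x /AB/MB.
- move=> A B [M M0 MA] [N N0 NB]; exists (M + N); first by rewrite addr_gt0.
  by move=> x [/MA|/NB] /le_trans-> //; rewrite ?lerDl ?lerDr ltW.
move=> x Kx; have nx := within_near cf Kx (@ltr01 R).
exists [set y | K y -> `|f x - f y| < 1] => //.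
exists (`|f x| + 1); first by rewrite ltr_wpDl.
move=> y /= [H Ky]; have fxy := H Ky; rewrite -(subrK (f x) (f y)) addrC.
by rewrite (le_trans (ler_normD _ _))// lerD2l distrC ltW.
Qed.

Lemma within_continuous_affine a f g : {within K, continuous f} ->
  {within K, continuous g} -> {within K, continuous (fun u => a * f u + g u)}.
Proof.
move=> cf cg; apply/subspace_continuousP => x Kx.
apply: cvgD; last by move/subspace_continuousP : cg; exact.
by apply: cvgM; [exact: cvg_cst|move/subspace_continuousP : cf; exact].
Qed.

(** Polynomials in t that converge to the absolute value of t on [-1, 1]: one step
    of the iteration p |-> p + (t^2 - p^2) / 2, whose fixed point is |t|. *)
Fixpoint sqrt_iter (n : nat) (t : R) : R :=
  if n is m.+1 then sqrt_iter m t + (t ^+ 2 - sqrt_iter m t ^+ 2) / 2 else 0.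

(** One step multiplies the error |t| - p by 1 - (|t| + p) / 2. *)
Lemma sqrt_iter_bound n t : `|t| <= 1 ->
  [/\ 0 <= sqrt_iter n t, sqrt_iter n t <= `|t| &
      `|t| - sqrt_iter n t <= `|t| * (1 - `|t| / 2) ^+ n].
Proof.
move=> t1; have t0 := normr_ge0 t; elim: n => [|n [p0 pt pn]] /=.
  by rewrite expr0 mulr1 subr0.
rewrite -real_normK ?num_real//; set a := `|t| in t0 t1 pt pn *.
set p := sqrt_iter n t in p0 pt pn *.
have eqn : a - (p + (a ^+ 2 - p ^+ 2) / 2) = (a - p) * (1 - (a + p) / 2) by field.
split.
- nra.
- by rewrite -subr_ge0 eqn mulr_ge0//; lra.
rewrite eqn exprSr mulrA; apply: (@le_trans _ _ ((a - p) * (1 - a / 2))).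
  by rewrite ler_wpM2l//; lra.
by rewrite ler_wpM2r//; lra.
Qed.

(** Bernoulli's inequality in the form that bounds the error of [sqrt_iter]
    independently of t. *)
Lemma geometric_error_le (a : R) n : 0 <= a <= 1 ->
  a * (1 - a / 2) ^+ n <= 2 / n.+1%:R.
Proof.
move=> /andP[a0 a1].
have H m : (1 - a / 2) ^+ m * (1 + m%:R * (a / 2)) <= 1.
  elim: m => [|m IH]; first by rewrite expr0 mul0r addr0 mulr1.
  apply: le_trans IH; rewrite exprSr -mulrA ler_wpM2l ?exprn_ge0//; first by lra.
  rewrite -natr1; have := ler0n R m; set k : R := m%:R; move=> k0.
  have : 0 <= k * a ^+ 2 by rewrite mulr_ge0// sqr_ge0.
  nra.
have := H n; set q := (1 - a / 2) ^+ n => Hq.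
have q0 : 0 <= q by rewrite exprn_ge0//; lra.
rewrite ler_pdivlMr// -natr1; set k : R := n%:R in Hq *; nra.
Qed.

Variable A : set (U -> R).
Hypothesis Acont : forall f, A f -> {within K, continuous f}.
Hypothesis Acst : forall c, A (fun=> c).
Hypothesis Alin : forall a f g, A f -> A g -> A (fun u => a * f u + g u).
Hypothesis Amul : forall f g, A f -> A g -> A (fun u => f u * g u).
Hypothesis Asep : forall x y, K x -> K y -> x <> y -> exists2 f, A f & f x <> f y.

(** The closure of A, shown below to be a lattice. *)
Let V f := uniform_closure K A f /\ {within K, continuous f}.

Let VA f : A f -> V f.
Proof. by move=> Af; split; [exact: sub_uniform_closure|exact: Acont]. Qed.

Let Vlin a f g : V f -> V g -> V (fun u => a * f u + g u).
Proof.
move=> [Vf cf] [Vg cg]; split; last exact: within_continuous_affine.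
have lA : linear_class A by split => //; exact: Acst.
exact: (uniform_closure_linear K lA).2.
Qed.

Let Asqrt_iter n f : A f -> A (fun u => sqrt_iter n (f u)).
Proof.
move=> Af; elim: n => [|n IH] /=; first exact: Acst.
rewrite (_ : (fun u => _) = fun u => (- 2^-1) * (sqrt_iter n (f u) * sqrt_iter n (f u))
  + (2^-1 * (f u * f u) + sqrt_iter n (f u))).
  by apply: Alin; [exact: Amul|apply: Alin => //; exact: Amul].
by apply/funext => u; field.
Qed.

Let Aabs f : A f -> V (fun u => `|f u|).
Proof.
move=> Af; split; last first.
  apply/subspace_continuousP => x Kx; apply: cvg_norm.
  by move/subspace_continuousP : (Acont Af); exact.
move=> e e0; have [M M0 fM] := compact_within_bounded (Acont Af).
have /ltr_add_invr[n] : 0 < e / (M * 2) by rewrite divr_gt0// mulr_gt0.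
rewrite add0r ltr_pdivlMr ?mulr_gt0// => ne.
exists (fun u => M * sqrt_iter n (M^-1 * f u + 0) + 0).
  apply: (Alin M (Asqrt_iter n _) (Acst 0)).
  exact: (Alin M^-1 Af (Acst 0)).
move=> u Ku; rewrite !addr0; have t1 : `|M^-1 * f u| <= 1.
  by rewrite normrM gtr0_norm ?invr_gt0// ler_pdivrMl// mulr1 fM.
have [p0 pt pn] := sqrt_iter_bound n t1.
have -> : `|f u| = M * `|M^-1 * f u|.
  by rewrite normrM gtr0_norm ?invr_gt0// mulVKf// gt_eqF.
rewrite -mulrBr normrM gtr0_norm// ger0_norm ?subr_ge0//.
rewrite -ler_pdivlMl//; apply: (le_trans pn).
apply: (le_trans (geometric_error_le _ _)); first by rewrite normr_ge0.
by rewrite ler_pdivlMl// mulrA mulrC ltW.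
Qed.

Let Vabs f : V f -> V (fun u => `|f u|).
Proof.
move=> [Vf cf]; split; last first.
  apply/subspace_continuousP => x Kx; apply: cvg_norm.
  by move/subspace_continuousP : cf; exact.
apply: (@uniform_closure_sub _ _ _ [set g | exists2 h, A h & g = fun u => `|h u|]).
  by move=> _ [h Ah ->]; exact: (Aabs Ah).1.
move=> e e0; have [g Ag fg] := Vf _ e0; exists (fun u => `|g u|).
  by exists g.
by move=> u Ku; rewrite (le_trans (ler_dist_dist _ _))// fg.
Qed.

Let Vmax f g : V f -> V g -> V (fun u => Num.max (f u) (g u)).
Proof.
move=> Vf Vg; rewrite (_ : (fun u => _) = fun u => 2^-1 * `|(-1) * g u + f u| +
   (2^-1 * f u + (2^-1 * g u + 0))).
  apply: Vlin; first exact/Vabs/Vlin.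
  by apply: Vlin => //; apply: Vlin => //; exact/VA.
by apply/funext => u; rewrite addr0 mulN1r [- _ + _]addrC maxr_absE; field.
Qed.

Let Vmin f g : V f -> V g -> V (fun u => Num.min (f u) (g u)).
Proof.
move=> Vf Vg; rewrite (_ : (fun u => _) = fun u => (- 2^-1) * `|(-1) * g u + f u| +
   (2^-1 * f u + (2^-1 * g u + 0))).
  apply: Vlin; first exact/Vabs/Vlin.
  by apply: Vlin => //; apply: Vlin => //; exact/VA.
by apply/funext => u; rewrite addr0 mulN1r [- _ + _]addrC minr_absE; field.
Qed.

Let interpolate f x y : K x -> K y -> exists2 g, V g & g x = f x /\ g y = f y.
Proof.
move=> Kx Ky; have [<-|xy] := pselect (x = y).
  by exists (fun=> f x) => //; exact: VA.
have [g Ag gxy] := Asep Kx Ky xy.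
have dxy : g y - g x != 0 by rewrite subr_eq0; apply/eqP/nesym.
exists (fun u => ((f y - f x) / (g y - g x)) * g u +
   (f x - (f y - f x) / (g y - g x) * g x)).
  by apply: VA; exact: Alin.
by split; field.
Qed.

(** The lattice proof: interpolating f at x and at each y, and taking a finite
    maximum over y, gives functions g_x > f - e / 2 on K with g_x x < f x + e / 2;
    a finite minimum over x is then within e / 2 of f. *)
Theorem stone_weierstrass f : {within K, continuous f} -> uniform_closure K A f.
Proof.
move=> cf e e0.
have one x : K x -> exists2 g, V g &
    g x < f x + e / 2 /\ forall y, K y -> f y - e / 2 < g y.
  move=> Kx; pose P (S : set U) := exists2 g, V g & g x < f x + e / 2 /\
    forall y, S y -> f y - e / 2 < g y.
  apply: (@compact_local_induction _ K P) => //.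
  - exists (fun=> f x); first exact: VA.
    by split => //; rewrite ltrDl divr_gt0.
  - by move=> B C BC [g Vg [gx gC]]; exists g => //; split => // y /BC/gC.
  - move=> B C [g Vg [gx gB]] [h Vh [hx hC]].
    exists (fun u => Num.max (g u) (h u)); first exact: Vmax.
    split; first by rewrite gt_max gx hx.
    by move=> y [/gB gy|/hC hy]; rewrite lt_max ?gy ?hy ?orbT.
  move=> y Ky; have [g Vg [gx gy]] := interpolate f Kx Ky.
  have e20 : 0 < e / 2 by rewrite divr_gt0.
  have := within_near (within_continuous_affine (a := -1) cf Vg.2) Ky e20.
  set N := (X in \near y, X y) => Ny.
  exists N => //; exists g => //; split.
    by rewrite gx ltrDl.
  by move=> z [H Kz]; have := H Kz; rewrite gy !mulN1r addNr sub0r ltr_norml => /andP[]; lra.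
have [K0|/set0P[x0 Kx0]] := eqVneq K set0.
  by exists (fun=> 0) => // u; rewrite K0.
pose P (S : set U) := exists2 g, V g & (forall y, K y -> f y - e / 2 < g y) /\
    forall y, S y -> g y < f y + e / 2.
have [g [Vg cg] [gl gu]] : P K.
  apply: (@compact_local_induction _ K P) => //.
  - by have [g Vg [_ gl]] := one _ Kx0; exists g.
  - by move=> B C BC [g Vg [gx gC]]; exists g => //; split => // y /BC/gC.
  - move=> B C [g Vg [gx gB]] [h Vh [hx hC]].
    exists (fun u => Num.min (g u) (h u)); first exact: Vmin.
    split=> [y Ky|y]; first by rewrite lt_min gx// hx.
    by move=> [/gB gy|/hC hy]; rewrite gt_min ?gy ?hy ?orbT.
  move=> x Kx; have [g Vg [gx gl]] := one _ Kx.
  have d0 : 0 < f x + e / 2 - g x by rewrite subr_gt0.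
  have := within_near (within_continuous_affine (a := -1) cf Vg.2) Kx d0.
  set N := (X in \near x, X x) => Nx.
  exists N => //; exists g => //; split => //.
  by move=> z [H Kz]; have := H Kz; rewrite !mulN1r ltr_norml => /andP[]; lra.
have [h Ah gh] := Vg (e / 2) ltac:(by rewrite divr_gt0).
exists h => // u Ku; rewrite [e]splitr (le_trans (ler_distD (g u) _ _))//.
rewrite lerD ?gh//; have := gl _ Ku; have := gu _ Ku.
by rewrite ler_norml => *; lra.
Qed.

End stone_weierstrass.

(** * Smooth functions of one variable *)

Section one_variable.
Context (R : realType).
Implicit Types (f sigma : R -> R) (B x y : R).

Lemma derivable_continuous1 f : (forall x, derivable f x 1) -> continuous f.
Proof.
by move=> df x; apply/differentiable_continuous/derivable1_diffP.
Qed.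

(** The intermediate point is located by norms, so that bounds on a ball apply to it
    whatever the order of x and y. *)
Lemma mean_value f x y : (forall x, derivable f x 1) ->
  exists z, [/\ `|z - x| <= `|y - x|, `|z| <= Num.max `|x| `|y| &
    f y - f x = derive1 f z * (y - x)].
Proof.
move=> df; have cf := derivable_continuous1 df.
have main a b : a <= b ->
    exists2 c, c \in `[a, b]%R & f b - f a = derive1 f c * (b - a).
  move=> ab; apply: MVT_segment => //; last exact: continuous_subspaceT.
  by move=> z _; rewrite derive1E; exact: derivableP.
have [xy|/ltW yx] := leP x y.
  have [z /[!in_itv]/= /andP[xz zy] fz] := main _ _ xy; exists z; split => //.
    by rewrite !ger0_norm ?subr_ge0// lerB.
  rewrite le_max; have [z0|z0] := leP 0 z.
    by rewrite (ger0_norm z0) (le_trans zy (ler_norm y)) orbT.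
  by rewrite (ltr0_norm z0) -(normrN x) (le_trans _ (ler_norm (- x))) ?lerN2.
have [z /[!in_itv]/= /andP[yz zx] fz] := main _ _ yx; exists z; split => //.
- by rewrite !ler0_norm ?subr_le0// lerN2 lerB.
- rewrite le_max; have [z0|z0] := leP 0 z.
    by rewrite (ger0_norm z0) (le_trans zx (ler_norm x)).
  by rewrite (ltr0_norm z0) -(normrN y) (le_trans _ (ler_norm (- y))) ?lerN2 ?orbT.
- by rewrite -[LHS]opprB fz -mulrN opprB.
Qed.

Lemma continuous_bounded f B : continuous f ->
  exists2 C : R, 0 < C & forall x, `|x| <= B -> `|f x| <= C.
Proof.
move=> cf; have cI : compact `[- B, B] by exact: segment_compact.
have cB : {within `[- B, B], continuous f} by exact: continuous_subspaceT.
have [C C0 fC] := compact_within_bounded cI cB; exists C => // x xB.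
by apply: fC; rewrite /= in_itv/= -ler_norml.
Qed.

Lemma smooth_continuous sigma n : smooth sigma -> continuous (derive1n n sigma).
Proof. by move=> ss; apply: derivable_continuous1 => x; exact: ss. Qed.

Lemma smooth_lipschitz sigma n B : smooth sigma -> exists2 C : R, 0 < C &
  forall x y, `|x| <= B -> `|y| <= B ->
    `|derive1n n sigma y - derive1n n sigma x| <= C * `|y - x|.
Proof.
move=> ss; have [C C0 fC] := continuous_bounded B (smooth_continuous (n := n.+1) ss).
exists C => // x y xB yB.
have [z [_ zxy ->]] := mean_value x y (fun t => ss n t).
rewrite normrM ler_wpM2r// -derive1nS fC//.
by rewrite (le_trans zxy)// ge_max xB.
Qed.

Lemma smooth_taylor1 sigma n B : smooth sigma -> exists2 C : R, 0 < C &
  forall x y, `|x| <= B -> `|y| <= B ->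
    `|derive1n n sigma y - derive1n n sigma x - (y - x) * derive1n n.+1 sigma x|
      <= C * `|y - x| ^+ 2.
Proof.
move=> ss; have [C C0 fC] := smooth_lipschitz n.+1 B ss.
exists C => // x y xB yB.
have [z [zx zxy ->]] := mean_value x y (fun t => ss n t).
rewrite -derive1nS mulrC -mulrBr normrM expr2 mulrA mulrC ler_wpM2r//.
apply: le_trans (fC _ _ xB _) _; first by rewrite (le_trans zxy)// ge_max xB.
by rewrite ler_wpM2l// ltW.
Qed.

Lemma poly_antiderivative (q : {poly R}) : exists p, p^`() = q.
Proof.
exists (\poly_(i < (size q).+1) (if i is j.+1 then q`_j / j.+1%:R else 0)).
apply/polyP => i; rewrite coef_deriv coef_poly ltnS.
case: ltnP => [iq|qi]; last by rewrite mul0rn nth_default.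
by rewrite -[LHS]mulr_natr divfK ?pnatr_eq0.
Qed.

(** Antiderivatives of polynomials are polynomials. *)
Lemma derive1n_eq0_poly n sigma : smooth sigma -> (forall x, derive1n n sigma x = 0) ->
  exists p : {poly R}, sigma =1 horner p.
Proof.
elim: n sigma => [|n IH] sigma ss sn.
  by exists 0 => x; rewrite horner0; exact: sn.
have [||q sq] := IH (derive1 sigma).
- by move=> m x; rewrite -derive1Sn; exact: ss.
- by move=> x; rewrite -derive1Sn sn.
have [p pq] := poly_antiderivative q.
exists (p + (sigma 0 - p.[0])%:P) => x; rewrite hornerD hornerC.
suff : sigma x - p.[x] = sigma 0 - p.[0] by move=> <-; rewrite addrC subrK.
apply: (@is_derive_0_is_cst _ (fun x => sigma x - p.[x])) => y.
have ds : is_derive y 1 sigma ('D_1 sigma y) := derivableP (ss 0 y).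
apply: (@trigger_derive _ _ _ ('D_1 sigma y - p^`().[y])).
by rewrite -derive1E sq pq subrr.
Qed.

(** The form in which non-polynomial activations enter: one derivative at a time,
    with a point b that depends on n. *)
Lemma non_polynomial_derive1n sigma n : smooth sigma -> non_polynomial sigma ->
  exists b, derive1n n sigma b != 0.
Proof.
move=> ss np; apply: contrapT => h; apply: np.
apply: (derive1n_eq0_poly (n := n) ss) => x; apply/eqP/negPn/negP => sx.
by apply: h; exists x.
Qed.

End one_variable.

(** * Density of shallow networks *)

(** The type T indexes a linear class of functionals [ev t] on U that separates
    the points of K; a neuron (w, t, b) stands for u |-> w sigma(ev t u + b). *)
Section shallow_networks.
Context (R : realType) (U : topologicalType) (K : set U) (T : Type).
Variables (ev : T -> U -> R) (sigma : R -> R).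
Hypothesis cK : compact K.
Hypothesis ev_cont : forall t, {within K, continuous (ev t)}.
Hypothesis ev_lin : forall a t1 t2,
  exists t, forall u, K u -> ev t u = a * ev t1 u + ev t2 u.
Hypothesis t0 : T.
Hypothesis ev_sep : forall x y, K x -> K y -> x <> y -> exists t, ev t x <> ev t y.
Hypothesis ss : smooth sigma.
Hypothesis np : non_polynomial sigma.

Definition shallow_value (ns : seq (R * T * R)) (u : U) : R :=
  \sum_(n <- ns) n.1.1 * sigma (ev n.1.2 u + n.2).

Definition shallow : set (U -> R) := [set f | exists ns, f = shallow_value ns].

Lemma shallow_linear : linear_class shallow.
Proof.
split=> [|a _ _ [ns ->] [ms ->]].
  by exists [::]; apply/funext => u; rewrite /shallow_value big_nil.
exists ([seq (a * n.1.1, n.1.2, n.2) | n <- ns] ++ ms).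
apply/funext => u; rewrite /shallow_value big_cat big_map mulr_sumr/=.
by congr (_ + _); apply: eq_bigr => n _; rewrite mulrA.
Qed.

Let V := uniform_closure K shallow.
Let Vlin : linear_class V := uniform_closure_linear K shallow_linear.

Let V_eq f g : (forall u, K u -> f u = g u) -> V f -> V g.
Proof.
move=> fg Vf e e0; have [h Sh fh] := Vf _ e0; exists h => // u Ku.
by rewrite -fg// fh.
Qed.

Definition monomial (ls : seq T) (u : U) : R := \prod_(l <- ls) ev l u.

Lemma monomial_cont ls : {within K, continuous (monomial ls)}.
Proof.
elim: ls => [|l ls IH].
  rewrite (_ : monomial _ = fun=> 1); last first.
    by apply/funext => u; rewrite /monomial big_nil.
  by apply: continuous_subspaceT => u; exact: cvg_cst.
rewrite (_ : monomial _ = fun u => ev l u * monomial ls u); last first.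
  by apply/funext => u; rewrite /monomial big_cons.
apply/subspace_continuousP => x Kx; apply: cvgM.
  by have /subspace_continuousP := ev_cont (t := l); exact.
by move/subspace_continuousP : IH; exact.
Qed.

(** Induction on the number of factors: the product with one factor more, ev l, is
    the derivative at h = 0 of monomial ls * sigma^(n)(h ev l + ev t + b), and a
    second order Taylor estimate makes the difference quotients converge
    uniformly on K. *)
Lemma monomial_derive_closure ls t b :
  V (fun u => monomial ls u * derive1n (size ls) sigma (ev t u + b)).
Proof.
elim: ls t b => [|l ls IH] t b.
  apply: sub_uniform_closure; exists [:: (1, t, b)]; apply/funext => u.
  by rewrite /shallow_value big_seq1 /monomial big_nil.
set n := size ls in IH *; set p := monomial ls in IH *.
have [P P0 pP] := compact_within_bounded cK (monomial_cont (ls := ls)).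
have [M M0 lM] := compact_within_bounded cK (ev_cont (t := l)).
have [B B0 tB] := compact_within_bounded cK (ev_cont (t := t)).
have [C C0 sC] := smooth_taylor1 n (B + `|b| + M) ss.
apply: (@uniform_closure_sub _ _ K V) => // e e0.
have D0 : 0 < P * (C * M ^+ 2) + 1 by rewrite ltr_wpDl// !mulr_ge0// ?sqr_ge0 ?ltW.
(* the step of the difference quotient; h <= 1 keeps the argument of sigma in
   the ball where C is valid *)
pose h := Num.min 1 (e / (P * (C * M ^+ 2) + 1)).
have h0 : 0 < h by rewrite lt_min ltr01 divr_gt0.
have h1 : h <= 1 by rewrite ge_min lexx.
have [th thE] := ev_lin h l t.
exists (fun u => h^-1 * (p u * derive1n n sigma (ev th u + b)) +
   ((- h^-1) * (p u * derive1n n sigma (ev t u + b)) + 0)).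
  apply: Vlin.2; first exact: IH.
  by apply: Vlin.2; [exact: IH|exact: Vlin.1].
move=> u Ku; rewrite addr0 thE//.
rewrite /monomial big_cons -/(monomial ls u) -/p /= -/n.
set x := ev t u + b; set y := h * ev l u + ev t u + b.
have yx : y - x = h * ev l u by rewrite /y /x; ring.
have xB : `|x| <= B + `|b| + M.
  rewrite (le_trans (ler_normD _ _))// -[leLHS]addr0 lerD ?(ltW M0)//.
  by rewrite lerD2r tB.
have hlM : `|h * ev l u| <= M.
  rewrite normrM gtr0_norm// (le_trans _ (lM _ Ku))//.
  by rewrite ler_piMl.
have yB : `|y| <= B + `|b| + M.
  rewrite /y -addrA addrC (le_trans (ler_normD _ _))// lerD//.
  by rewrite (le_trans (ler_normD _ _))// lerD2r tB.
have := sC x y xB yB; rewrite yx => E.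
have -> : ev l u * p u * derive1n n.+1 sigma x - (h^-1 * (p u * derive1n n sigma y) +
    (- h^-1) * (p u * derive1n n sigma x)) =
    - (p u * h^-1 * (derive1n n sigma y - derive1n n sigma x - h * ev l u * derive1n n.+1 sigma x)).
  by field; rewrite gt_eqF.
rewrite normrN !normrM; apply: (@le_trans _ _ (P * `|h^-1| * (C * `|h * ev l u| ^+ 2))).
  by rewrite ler_pM ?mulr_ge0// ler_wpM2r// pP.
rewrite normfV normrM exprMn !(gtr0_norm h0).
have -> : P * h^-1 * (C * (h ^+ 2 * `|ev l u| ^+ 2)) = h * (P * (C * `|ev l u| ^+ 2)).
  by field; rewrite gt_eqF.
apply: (@le_trans _ _ (h * (P * (C * M ^+ 2) + 1))); last first.
  by rewrite -ler_pdivlMr// ge_min lexx orbT.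
rewrite ler_wpM2l ?(ltW h0)//; apply: (@le_trans _ _ (P * (C * M ^+ 2))).
  by rewrite !(ler_wpM2l, lerXn2r) ?nnegrE ?(ltW P0) ?(ltW C0) ?(ltW M0) ?lM.
by rewrite lerDl.
Qed.

(** Take ev t = 0 on K and divide by the value of sigma^(n) at a point
    where it is not 0. *)
Lemma monomial_closure ls : V (monomial ls).
Proof.
have [b sb] := non_polynomial_derive1n (size ls) ss np.
(* ev z vanishes on K *)
have [z zE] := ev_lin (-1) t0 t0.
have := Vlin.2 ((derive1n (size ls) sigma b)^-1) _ _ (monomial_derive_closure ls z b) Vlin.1.
apply: V_eq => u Ku; rewrite zE// mulN1r addNr add0r addr0 mulrC.
by rewrite mulfK.
Qed.

Definition monomial_sum (s : seq (R * seq T)) (u : U) : R :=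
  \sum_(m <- s) m.1 * monomial m.2 u.

Theorem shallow_dense f : {within K, continuous f} -> V f.
Proof.
move=> cf; pose A : set (U -> R) := [set f | exists s, f = monomial_sum s].
have AV : A `<=` V.
  move=> _ [s ->]; elim: s => [|m s IH].
    apply: V_eq Vlin.1 => u _; by rewrite /monomial_sum big_nil.
  apply: V_eq (Vlin.2 m.1 _ _ (monomial_closure m.2) IH) => u _.
  by rewrite /monomial_sum big_cons.
apply: (uniform_closure_sub AV).
apply: stone_weierstrass => //.
- move=> _ [s ->]; elim: s => [|m s IH].
    rewrite (_ : monomial_sum _ = fun=> 0).
      by apply: continuous_subspaceT => u; exact: cvg_cst.
    by apply/funext => u; rewrite /monomial_sum big_nil.
  rewrite (_ : monomial_sum _ = fun u => m.1 * monomial m.2 u + monomial_sum s u).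
    by apply: within_continuous_affine => //; exact: monomial_cont.
  by apply/funext => u; rewrite /monomial_sum big_cons.
- move=> c; exists [:: (c, [::])]; apply/funext => u.
  by rewrite /monomial_sum big_seq1 /monomial big_nil mulr1.
- move=> a _ _ [s ->] [r ->]; exists ([seq (a * m.1, m.2) | m <- s] ++ r).
  apply/funext => u; rewrite /monomial_sum big_cat big_map mulr_sumr/=.
  by congr (_ + _); apply: eq_bigr => n _; rewrite mulrA.
- move=> _ _ [s ->] [r ->].
  exists [seq (m.1 * q.1, m.2 ++ q.2) | m <- s, q <- r].
  apply/funext => u; rewrite /monomial_sum big_allpairs_dep/= mulr_suml.
  apply: eq_bigr => m _; rewrite mulr_sumr; apply: eq_bigr => q _.
  by rewrite /monomial big_cat/= mulrACA.
move=> x y Kx Ky xy; have [t txy] := ev_sep Kx Ky xy.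
exists (ev t) => //; exists [:: (1, [:: t])]; apply/funext => u.
by rewrite /monomial_sum big_seq1 mul1r /monomial big_seq1.
Qed.

(** One list of neurons serves finitely many targets: concatenate their lists and
    give each neuron weight 0 for the targets it does not come from. *)
Theorem shallow_dense_family (X : finType) (F : X -> U -> R) (e : R) :
  (forall x, {within K, continuous (F x)}) -> 0 < e ->
  exists (p : nat) (W : 'I_p -> X -> R) (t : 'I_p -> T) (b : 'I_p -> R),
    forall x u, K u ->
      `|F x u - \sum_(i < p) W i x * sigma (ev (t i) u + b i)| <= e.
Proof.
move=> cF e0.
have /choice[ns nsE] : forall x, exists ns, forall u, K u ->
    `|F x u - shallow_value ns u| <= e.
  by move=> x; have [_ [ns ->] H] := shallow_dense (cF x) e0; exists ns.
pose s := [seq (x, n) | x <- enum X, n <- ns x].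
pose i0 i : X * (R * T * R) := tnth (in_tuple s) i.
exists (size s), (fun i x => ((i0 i).1 == x)%:R * (i0 i).2.1.1),
  (fun i => (i0 i).2.1.2), (fun i => (i0 i).2.2) => x u Ku.
rewrite -(big_tnth _ _ s xpredT
  (fun y => (y.1 == x)%:R * y.2.1.1 * sigma (ev y.2.1.2 u + y.2.2))).
rewrite big_allpairs_dep big_enum/= (bigD1 x)//= [X in _ - (_ + X)]big1 ?addr0.
  apply: le_trans (nsE x u Ku); rewrite le_eqVlt; apply/orP; left; apply/eqP.
  congr `|_ - _|; apply: eq_bigr => n _; by rewrite eqxx mul1r.
by move=> y /negbTE yx; apply: big1 => n _; rewrite yx !mul0r.
Qed.

End shallow_networks.

(** * Lebesgue measure and integrals over a bounded open set *)

Section column_vectors.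
Context (R : realType) (n : nat).
Implicit Types x y : 'cV[R]_n.

Lemma cV_norm_le x e : 0 <= e -> (forall i, `|x i 0| <= e) -> `|x| <= e.
Proof.
move=> e0 xe; rewrite /Num.Def.normr/= mx_normrE; apply: bigmax_le => // -[i j] _.
by rewrite /= ord1 xe.
Qed.

Lemma cV_norm_ge x i : `|x i 0| <= `|x|.
Proof.
rewrite [leRHS]/Num.Def.normr/= mx_normrE.
exact: (@le_bigmax _ _ _ 0 (fun ij : 'I_n * 'I_1 => `|x ij.1 ij.2|) (i, ord0)).
Qed.

Lemma cV_ballP x e y : 0 < e -> ball x e y <-> forall i, `|x i 0 - y i 0| < e.
Proof.
move=> e0; split => [[_ xy] i|xy]; first exact: xy.
by split=> // i j; rewrite ord1; exact: xy.
Qed.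

End column_vectors.

Section lebesgue_facts.
Variable R : realType.
Local Notation tR n := (n.-tuple (measurableTypeR R)).

Definition cV_of_tuple d (t : tR d) : 'cV[R]_d := \col_i tnth t i.

Lemma tuple_of_cVK d : cancel (@tuple_of_cV R d) (@cV_of_tuple d).
Proof. by move=> x; apply/colP => i; rewrite mxE tnth_mktuple. Qed.

Lemma cV_of_tupleK d : cancel (@cV_of_tuple d) (@tuple_of_cV R d).
Proof. by move=> t; apply: eq_from_tnth => i; rewrite tnth_mktuple mxE. Qed.

Lemma image_tuple_of_cV d (A : set 'cV[R]_d) :
  [set tuple_of_cV x | x in A] = @cV_of_tuple d @^-1` A.
Proof.
apply/seteqP; split=> [_ [x Ax <-]/=|t /= At]; first by rewrite tuple_of_cVK.
by exists (cV_of_tuple t) => //; rewrite cV_of_tupleK.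
Qed.

Definition tuple_box d (c : 'I_d -> R) (r : R) : set (tR d) :=
  [set t | forall i, `|c i - tnth t i| < r].

Lemma measurable_tuple_box d (c : 'I_d -> R) r : measurable (tuple_box c r).
Proof.
rewrite (_ : tuple_box c r =
    \bigcap_(i in [set: 'I_d]) ((@tnth d R)^~ i @^-1` `]c i - r, c i + r[)).
  apply: fin_bigcap_measurable => // i _; rewrite -[X in measurable X]setTI.
  exact: measurable_tnth.
apply/seteqP; split=> t /= H i.
  by move=> _ /=; rewrite in_itv/= -ltr_distlC H.
by have := H i I; rewrite /= in_itv/= -ltr_distlC.
Qed.

(** An open set is the countable union of the rational boxes that it contains. *)
Lemma measurable_preimage_open d (A : set 'cV[R]_d) : open A ->
  measurable (@cV_of_tuple d @^-1` A).
Proof.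
move=> oA; pose I := ({ffun 'I_d -> rat} * rat)%type.
pose F (p : I) : set (tR d) :=
  if `[< tuple_box (fun i => ratr (p.1 i)) (ratr p.2) `<=` @cV_of_tuple d @^-1` A >]
  then tuple_box (fun i => ratr (p.1 i)) (ratr p.2) else set0.
rewrite (_ : _ @^-1` _ = \bigcup_p F p).
  apply: countable_bigcupT_measurable => [|p]; first exact: countableP.
  rewrite /F; case: ifP => // _.
  exact: measurable_tuple_box.
apply/seteqP; split=> [t /= At|t [p _]]; last first.
  by rewrite /F; case: asboolP => // + Ft; exact.
have /nbhs_ballP[e /= e0 eA] : nbhs (cV_of_tuple t) A by exact: open_nbhs_nbhs.
have [r] : exists r : rat, ratr r \in `]0, e / 2[.
  by apply: rat_in_itvoo; rewrite divr_gt0.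
rewrite in_itv/= => /andP[r0 re].
have /choice[c cr] : forall i, exists q : rat, `|ratr q - tnth t i| < ratr r.
  move=> i; have [|q] := @rat_in_itvoo R (tnth t i - ratr r) (tnth t i + ratr r).
    by rewrite ltrBlDr -addrA ltrDl addr_gt0.
  by rewrite in_itv/= -ltr_distl; exists q.
exists ([ffun i => c i], r) => //; rewrite /F asboolT/=.
  by move=> i; rewrite ffunE.
move=> z /= zc; apply: eA; apply/cV_ballP => // i; rewrite !mxE.
rewrite [e]splitr (le_lt_trans (ler_distD (ratr (c i)) _ _))//.
rewrite ltrD//; first by rewrite distrC (lt_trans (cr i)).
by have := zc i; rewrite /= ffunE => /lt_trans; apply.
Qed.

(** The outer measure on column vectors is that on tuples carried along a
    bijection, so the Caratheodory condition carries over. *)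
Lemma measurable_lebesgue_open d (A : set 'cV[R]_d) : open A ->
  measurable (A : set (lebesgue_type R d)).
Proof.
move=> oA; have mA := measurable_preimage_open oA.
have cA : caratheodory_measurable ((lebesgue_tuple R d)^*)%mu (@cV_of_tuple d @^-1` A).
  exact: (@caratheodory_measurable_mu_ext _ _ _ (lebesgue_tuple R d) _ mA).
suff : caratheodory_measurable (@lebesgue_outer R d) A by [].
move=> X; rewrite /= /lebesgue_outer !image_tuple_of_cV !preimage_setI.
exact: cA.
Qed.

Lemma lebesgue_openE d (A : set 'cV[R]_d) : open A ->
  lebesgue d A = lebesgue_tuple R d (@cV_of_tuple d @^-1` A).
Proof.
move=> oA; rewrite /lebesgue /lebesgue_outer image_tuple_of_cV.
by apply: measurable_mu_extE; exact: measurable_preimage_open.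
Qed.

Lemma lebesgue_tuple_box d (c : 'I_d -> R) r : 0 < r ->
  lebesgue_tuple R d (tuple_box c r) = ((r *+ 2) ^+ d)%:E.
Proof.
move=> r0; elim: d c => [|d IH] c.
  by rewrite /= diracE mem_set//= => -[].
rewrite /= /lebesgue_cons /pushforward.
rewrite (_ : _ @^-1` _ = `]c ord0 - r, c ord0 + r[%classic `*`
    tuple_box (fun i => c (lift ord0 i)) r).
  rewrite product_measure1E//=; last exact: measurable_tuple_box.
  rewrite IH lebesgue_measure_itv/= lte_fin ifT.
    by rewrite -EFinB -EFinM exprS; congr ((_ * _)%:E); ring.
  by rewrite ltrBlDr -addrA ltrDl addr_gt0.
apply/seteqP; split=> -[x t] /=.
  move=> H; split; first by have := H ord0; rewrite in_itv/= -ltr_distlC.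
  by move=> i; have := H (lift ord0 i); rewrite !(tnth_nth 0).
rewrite in_itv/= -ltr_distlC => -[xr tr] i.
case: (unliftP ord0 i) => [j|] -> //.
by have := tr j; rewrite !(tnth_nth 0).
Qed.

Lemma preimage_ball d (x : 'cV[R]_d) e : 0 < e ->
  @cV_of_tuple d @^-1` (ball x e) = tuple_box (fun i => x i 0) e.
Proof.
move=> e0; apply/seteqP; split=> t /=.
  by move=> /(cV_ballP _ _ e0) H i; have := H i; rewrite mxE.
by move=> H; apply/(cV_ballP _ _ e0) => i; rewrite mxE.
Qed.

Lemma lebesgue_ball d (x : 'cV[R]_d) e : 0 < e ->
  lebesgue d (ball x e) = ((e *+ 2) ^+ d)%:E.
Proof.
move=> e0; rewrite lebesgue_openE; last exact: ball_open.
by rewrite preimage_ball// lebesgue_tuple_box.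
Qed.

Lemma lebesgue_open_gt0 d (A : set 'cV[R]_d) : open A -> A !=set0 ->
  (0 < lebesgue d A)%E.
Proof.
move=> oA [x Ax].
have /nbhs_ballP[e /= e0 eA] : nbhs x A by exact: open_nbhs_nbhs.
apply: (@lt_le_trans _ _ (lebesgue d (ball x e))).
  by rewrite lebesgue_ball// lte_fin exprn_gt0// mulrn_wgt0.
by apply: le_outer_measure.
Qed.

Lemma lebesgue_bounded_fin d (A : set 'cV[R]_d) : bounded_set A ->
  (lebesgue d A < +oo)%E.
Proof.
move=> [M [_ AM]]; pose N := `|M| + 1.
have N0 : 0 < N by rewrite ltr_wpDl.
apply: (@le_lt_trans _ _ (lebesgue d (ball 0 (N + 1)))); last first.
  by rewrite lebesgue_ball ?ltry// addr_gt0.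
apply: le_outer_measure => x Ax; apply/cV_ballP; first by rewrite addr_gt0.
move=> i; rewrite mxE sub0r normrN.
have := AM N; rewrite (le_lt_trans (ler_norm M)) ?ltrDl// => /(_ isT x Ax)/= xN.
by rewrite (le_lt_trans (cV_norm_ge x i))// (le_lt_trans xN)// ltrDl.
Qed.

End lebesgue_facts.

Section integrable_on_domain.
Context (R : realType) (d : nat) (Omega : set 'cV[R]_d).
Hypothesis oO : open Omega.
Hypothesis bO : bounded_set Omega.
Implicit Types f g : 'cV[R]_d -> R.

(** Continuity is required of f as a function on the whole space, at the points of
    Omega: an element of C^s(Omega) is extended by 0 and may jump at the
    boundary. *)
Definition bounded_continuous f :=
  (forall x, Omega x -> {for x, continuous f}) /\
  exists M : R, forall x, Omega x -> `|f x| <= M.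

Lemma bounded_continuous_measurable f : bounded_continuous f ->
  measurable_fun (Omega : set (lebesgue_type R d)) f.
Proof.
move=> [cf _]; apply: (measurability _ (RGenOpens.measurableE R)).
move=> _ [_ [a [b ->] <-]]; apply: measurable_lebesgue_open.
rewrite openE => x [Ox fx]; apply: filterI; first exact: open_nbhs_nbhs.
by apply: cf => //; apply: open_nbhs_nbhs; split => //; exact: interval_open.
Qed.

Lemma bounded_continuous_integrable f : bounded_continuous f ->
  (lebesgue d).-integrable Omega (EFin \o f).
Proof.
move=> bf; apply: measurable_bounded_integrable.
- exact: measurable_lebesgue_open.
- exact: lebesgue_bounded_fin.
- exact: bounded_continuous_measurable.
have [_ [M fM]] := bf; exists M; split; first exact: num_real.
by move=> N MN x /fM /le_trans; apply; exact: ltW.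
Qed.

Lemma bounded_continuousM f g : bounded_continuous f -> bounded_continuous g ->
  bounded_continuous (fun x => f x * g x).
Proof.
move=> [cf [M fM]] [cg [N gN]]; split=> [x Ox|].
  by apply: (@continuousM _ _ f g); [exact: cf|exact: cg].
by exists (M * N) => x Ox; rewrite normrM ler_pM// ?fM ?gN.
Qed.

Lemma bounded_continuous_affine a f g : bounded_continuous f ->
  bounded_continuous g -> bounded_continuous (fun x => a * f x + g x).
Proof.
move=> [cf [M fM]] [cg [N gN]]; split=> [x Ox|].
  apply: (@continuousD _ _ _ (fun x => a * f x) g); last exact: cg.
  by apply: (@continuousM _ _ (fun=> a) f); [exact: cst_continuous|exact: cf].
exists (`|a| * M + N) => x Ox; rewrite (le_trans (ler_normD _ _))//.
by rewrite lerD ?gN// normrM ler_wpM2l ?fM.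
Qed.

Lemma bounded_continuous_cst c : bounded_continuous (fun=> c).
Proof. by split=> [x _|]; [exact: cst_continuous|exists `|c|]. Qed.

Local Notation integral f := (Rintegral (lebesgue d) Omega f).

Lemma Rintegral_affine a f g : bounded_continuous f -> bounded_continuous g ->
  integral (fun x => a * f x + g x) = a * integral f + integral g.
Proof.
move=> bf bg; have mO := measurable_lebesgue_open oO.
rewrite RintegralD//; last 2 first.
- have b0 := bounded_continuous_affine a bf (bounded_continuous_cst 0).
  have := bounded_continuous_integrable b0.
  by congr (integrable _ _ _); apply/funext => x /=; rewrite addr0.
- exact: bounded_continuous_integrable.
by rewrite RintegralZl//; exact: bounded_continuous_integrable.
Qed.

Lemma Rintegral_cst_domain c : integral (fun=> c) = c * fine (lebesgue d Omega).
Proof.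
by rewrite Rintegral_cst//; exact: measurable_lebesgue_open.
Qed.

Lemma fine_lebesgue_gt0 : Omega !=set0 -> 0 < fine (lebesgue d Omega).
Proof.
move=> O0; rewrite fine_gt0// lebesgue_open_gt0//=.
exact: lebesgue_bounded_fin.
Qed.

Lemma le_Rintegral_abs f M : bounded_continuous f ->
  (forall x, Omega x -> `|f x| <= M) ->
  `|integral f| <= M * fine (lebesgue d Omega).
Proof.
move=> bf fM; have mO := measurable_lebesgue_open oO.
have intf := bounded_continuous_integrable bf.
rewrite (le_trans (le_normr_Rintegral _ _))// -Rintegral_cst_domain.
apply: le_Rintegral => //; first exact: (integrable_abse intf).
exact: (bounded_continuous_integrable (bounded_continuous_cst M)).
Qed.

(** If f x != 0 then the square of f exceeds a positive constant on a nonempty open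
    set, which has positive measure. *)
Lemma Rintegral_sqr_eq0 f : bounded_continuous f ->
  integral (fun x => f x * f x) = 0 -> forall x, Omega x -> f x = 0.
Proof.
move=> bf I0 x Ox; apply: contrapT => /eqP fx0; have mO := measurable_lebesgue_open oO.
pose c := `|f x| / 2; have c0 : 0 < c by rewrite divr_gt0// normr_gt0.
pose A := Omega `&` [set y | c < `|f y|].
have oA : open A.
  rewrite openE => y [Oy fy]; apply: filterI; first exact: open_nbhs_nbhs.
  exact: (cvgr_gt `|f y| (continuous_comp (bf.1 _ Oy) (@norm_continuous _ _ (f y)))).
have A0 : A !=set0.
  exists x; split => //=.
  by rewrite /c ltr_pdivrMr// ltr_pMr ?normr_gt0// ltr1n.
have AO : A `<=` Omega by move=> y [].
have bA : bounded_set A.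
  by move: bO => [M [Mr OM]]; exists M; split => // N /OM h y /AO; exact: h.
have bff := bounded_continuousM bf bf.
have iff := bounded_continuous_integrable bff.
have mA := measurable_lebesgue_open oA.
have : c ^+ 2 * fine (lebesgue d A) <= integral (fun x => f x * f x).
  rewrite -Rintegral_cst//.
  have mOA : measurable ((Omega `\` A) : set (lebesgue_type R d)) by exact: measurableD.
  have UA : A `|` (Omega `\` A) = Omega by rewrite setDUK.
  rewrite -[in leRHS]UA Rintegral_setU//; last 2 first.
  - by rewrite UA.
  - by apply/disj_setPS => y [Ay [_ /(_ Ay)]].
  rewrite -[leLHS]addr0 lerD//; last by apply: Rintegral_ge0 => y _; rewrite -expr2 sqr_ge0.
  apply: le_Rintegral => //.
  - apply: measurable_bounded_integrable => //; first exact: lebesgue_bounded_fin.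
    by exists (c ^+ 2); split => [|N cN y _]; rewrite ?num_real// ger0_norm ?sqr_ge0 ?ltW.
  - exact: (integrableS mO).
  move=> y [_ /= cy]; rewrite -expr2 -[leRHS]real_normK ?num_real//.
  by rewrite lerXn2r ?nnegrE ?(ltW c0) ?(ltW cy).
rewrite I0 leNgt mulr_gt0// ?exprn_gt0// fine_gt0// lebesgue_open_gt0//=.
exact: lebesgue_bounded_fin.
Qed.

End integrable_on_domain.

(** * Products and compositions in C^s *)

Section subsequences.
Context (I : eqType).

Lemma subseq_cat_split (s s1 s2 : seq I) : subseq s (s1 ++ s2) ->
  exists t1 t2, [/\ s = t1 ++ t2, subseq t1 s1 & subseq t2 s2].
Proof.
move=> /subseqP[m sm ->]; rewrite size_cat in sm.
exists (mask (take (size s1) m) s1), (mask (drop (size s1) m) s2).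
rewrite !mask_subseq -mask_cat ?cat_take_drop//.
by rewrite size_takel// sm leq_addr.
Qed.

Lemma subseq_nseq (s : seq I) n x : subseq s (nseq n x) ->
  exists2 m, (m <= n)%N & s = nseq m x.
Proof.
move=> h; exists (size s); first by rewrite -(size_nseq n x) size_subseq.
apply/all_pred1P/allP => y /(mem_subseq h); rewrite mem_nseq => /andP[_ /eqP->] /=.
by rewrite eqxx.
Qed.

(** A subsequence of a list sorted in blocks is again a list of blocks; this is
    why partial derivatives along subsequences of a multi-index are
    again indexed by multi-indices. *)
Lemma subseq_flatten_nseq (a : I -> nat) (r s : seq I) : uniq r ->
  subseq s (flatten [seq nseq (a i) i | i <- r]) ->
  exists b : I -> nat, (forall i, (b i <= a i)%N) /\
    s = flatten [seq nseq (b i) i | i <- r].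
Proof.
elim: r s => [|i r IH] s /=.
  by move=> _ /eqP ->; exists (fun=> 0%N).
move=> /andP[ir ur] /subseq_cat_split[t1 [t2 [-> /subseq_nseq[m ma ->] h2]]].
have [b [ba ->]] := IH _ ur h2.
exists (fun j => if j == i then m else b j); split=> [j|].
  by case: eqP => // ->.
rewrite eqxx; congr (_ ++ flatten _); apply/eq_in_map => j jr.
by case: eqP jr ir => // -> ->.
Qed.

End subsequences.

Section multi_indices.
Context (R : realType) (d s : nat) (W : normedModType R).

Definition multi_seq (alpha : multi_index d s) : seq 'I_d :=
  flatten [seq nseq (alpha i) i | i <- enum 'I_d].

Lemma subseq_multi_seq (alpha : multi_index d s) l : order_le alpha ->
  subseq l (multi_seq alpha) ->
  exists2 beta : multi_index d s, order_le beta & l = multi_seq beta.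
Proof.
move=> oa /subseq_flatten_nseq[|b [ba ->]]; first exact: enum_uniq.
have bs i : (b i < s.+1)%N by rewrite (leq_ltn_trans (ba i)).
exists [ffun i => Ordinal (bs i)].
  move: oa; rewrite /order_le; apply: leq_trans; apply: leq_sum => i _.
  by rewrite ffunE; exact: ba.
by congr flatten; apply: eq_map => i; rewrite ffunE.
Qed.

Lemma Cs_norm_ge_partials (A : set 'cV[R]_d) (f : 'cV[R]_d -> W) alpha l :
  (Cs_norm s A f < +oo)%E -> order_le alpha -> subseq l (multi_seq alpha) ->
  forall x, A x -> `|partials l f x| <= fine (Cs_norm s A f).
Proof.
move=> foo oa /(subseq_multi_seq oa)[beta ob ->] x Ax.
rewrite -lee_fin fineK ?ge0_fin_numE ?Cs_norm_ge0// /Cs_norm.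
rewrite asboolT; last exact: Cs_norm_fin.
apply: (@le_trans _ _ (nnsup A (fun x => `|dmulti beta f x|%:E))).
  exact: (nnsup_ub (fun x => `|dmulti beta f x|%:E)).
rewrite (bigD1 beta)//= leeDl//; apply: sume_ge0 => *; exact: nnsup_ge0.
Qed.

Lemma Cs_norm_le (A : set 'cV[R]_d) (f : 'cV[R]_d -> W) M : 0 <= M ->
  Cs_at s A f ->
  (forall alpha x, order_le alpha -> A x -> `|partials (multi_seq alpha) f x| <= M) ->
  (Cs_norm s A f <= (M *+ #|{: multi_index d s}|)%:E)%E.
Proof.
move=> M0 sf fM; rewrite /Cs_norm asboolT//.
apply: (@le_trans _ _ (\sum_(alpha : multi_index d s | order_le alpha) M%:E)%E).
  by apply: lee_sum => alpha oa; apply: nnsup_le => // x Ax; rewrite lee_fin fM.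
rewrite sumEFin lee_fin -sumr_const big_mkcond/=; apply: ler_sum => alpha _.
by case: ifP.
Qed.

End multi_indices.

Section Cs_functions.
Context (R : realType) (d : nat) (A : set 'cV[R]_d).
Hypothesis oA : open A.

Section vector_valued.
Context (W : normedModType R).
Implicit Types (f g : 'cV[R]_d -> W) (l : seq 'I_d).

Lemma partials_rcons l i f : partials (rcons l i) f = partials l (partial i f).
Proof. by rewrite /partials foldr_rcons. Qed.

Lemma near_open (P : set 'cV[R]_d) x : A x -> (forall y, A y -> P y) ->
  \forall y \near x, P y.
Proof.
by move=> Ax AP; apply: filterS AP _; exact: open_nbhs_nbhs.
Qed.

Lemma near_eq_open (T : Type) (F G : 'cV[R]_d -> T) x : A x ->
  (forall y, A y -> F y = G y) -> {near x, F =1 G}.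
Proof. by move=> Ax FG; near=> y; apply: FG; near: y; exact: near_open.
Unshelve. all: by end_near. Qed.

Lemma partials_eq f g l : (forall x, A x -> f x = g x) ->
  forall x, A x -> partials l f x = partials l g x.
Proof.
move=> fg; elim: l => [//|i l IH] x Ax /=.
by apply: near_eq_derive; exact: near_open.
Qed.

Lemma Cs_at_eq s f g : (forall x, A x -> f x = g x) -> Cs_at s A f -> Cs_at s A g.
Proof.
move=> fg sf l ls; have [cf df] := sf l ls; split=> [x Ax|sl i x Ax].
  rewrite /prop_for /continuous_at -(partials_eq _ fg)//.
  have E := near_eq_open Ax (partials_eq l fg).
  by apply: cvg_trans (near_eq_cvg E) _; exact: cf.
exact: (near_eq_derivable (near_eq_open Ax (partials_eq l fg)) (df sl i x Ax)).
Qed.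

Lemma Cs_atW s f : Cs_at s.+1 A f -> Cs_at s A f.
Proof.
move=> sf l ls; have [cf df] := sf l (leqW ls); split=> // sl.
by apply: df; exact: leqW.
Qed.

Lemma Cs_at_le s t f : (s <= t)%N -> Cs_at t A f -> Cs_at s A f.
Proof.
move=> st sf l ls; have [cf df] := sf l (leq_trans ls st); split=> // sl.
by apply: df; exact: leq_trans st.
Qed.

Lemma Cs_at_continuous s f x : Cs_at s A f -> A x -> {for x, continuous f}.
Proof. by move=> /(_ [::] (leq0n _))[cf _]; exact: cf. Qed.

Lemma Cs_at0P f : (forall x, A x -> {for x, continuous f}) -> Cs_at 0 A f.
Proof. by move=> cf [|//] _; split. Qed.

(** The derivatives of order at most s + 1 are f and the derivatives of order at
    most s of the first derivatives; this allows inductions that peel off the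
    innermost derivative. *)
Lemma Cs_atSP s f : Cs_at s.+1 A f <->
  (forall x, A x -> {for x, continuous f}) /\
  forall i, (forall x, A x -> derivable f x (delta_mx i 0)) /\
            Cs_at s A (partial i f).
Proof.
split=> [sf|[cf sf] l].
  split=> [x|i]; first exact: (Cs_at_continuous sf).
  split=> [x Ax|l ls]; first exact: (sf [::] isT).2.
  have := sf (rcons l i); rewrite size_rcons ltnS partials_rcons => /(_ ls)[cf df].
  by split.
case/lastP: l => [|l i] ls; first by split=> // _ i x Ax; exact: (sf i).1.
rewrite partials_rcons; move: ls; rewrite size_rcons => ls.
exact: (sf i).2.
Qed.

End vector_valued.

Implicit Types (f g : 'cV[R]_d -> R^o) (l : seq 'I_d).

Lemma partial_mul f g i x : derivable f x (delta_mx i 0) ->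
  derivable g x (delta_mx i 0) ->
  partial i (f * g) x = f x * partial i g x + partial i f x * g x.
Proof.
move=> df dg; rewrite /partial (deriveM df dg); congr (_ + _).
exact: mulrC.
Qed.

Lemma Cs_at_add s f g : Cs_at s A f -> Cs_at s A g -> Cs_at s A (f + g).
Proof. by move=> sf sg; rewrite -[f]scale1r; exact: Cs_at_linear. Qed.

Lemma Cs_at_mul s f g : Cs_at s A f -> Cs_at s A g -> Cs_at s A (f * g).
Proof.
elim: s f g => [|s IH] f g sf sg.
  apply: Cs_at0P => x Ax; apply: continuousM.
    exact: (Cs_at_continuous sf).
  exact: (Cs_at_continuous sg).
have sf' := Cs_atW sf; have sg' := Cs_atW sg.
move/Cs_atSP : sf => [cf sf]; move/Cs_atSP : sg => [cg sg].
apply/Cs_atSP; split=> [x Ax|i].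
  by apply: continuousM; [exact: cf|exact: cg].
split=> [x Ax|]; first by apply: derivableM; [exact: (sf i).1|exact: (sg i).1].
apply: (@Cs_at_eq _ s (f * partial i g + partial i f * g)) => [x Ax|].
  by rewrite partial_mul//; [exact: (sf i).1|exact: (sg i).1].
exact: (Cs_at_add (IH _ _ sf' (sg i).2) (IH _ _ (sf i).2 sg')).
Qed.

Lemma derive_line (W : normedModType R) (f : 'cV[R]_d -> W) x v :
  'D_v f x = 'D_1 (fun h : R => f (h *: v + x)) 0.
Proof.
rewrite /derive; set g1 := fun h => h^-1 *: _; set g2 := fun h => h^-1 *: _.
suff -> : g1 = g2 by []; apply/funext => h; rewrite /g1 /g2 /=.
have -> : h *: (1 : R) + 0 = h by rewrite addr0 /GRing.scale/= mulr1.
by rewrite scale0r add0r.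
Qed.

(** A directional derivative is the derivative of the restriction to a line, which
    brings this down to the chain rule in one variable. *)
Lemma is_derive_comp1 (phi : R -> R) f x v : derivable f x v ->
  derivable phi (f x) 1 ->
  derivable (phi \o f : _ -> R^o) x v /\
  'D_v (phi \o f : _ -> R^o) x = derive1 phi (f x) * 'D_v f x.
Proof.
move=> df dphi; pose line (h : R) : R := f (h *: v + x).
have line0 : line 0 = f x by rewrite /line scale0r add0r.
have dline : is_derive (0 : R) (1 : R) line ('D_v f x).
  apply: DeriveDef; first exact: (derivable1P f x v).1.
  exact/esym/derive_line.
have dphi0 : is_derive (line 0) (1 : R) phi (derive1 phi (f x)).
  by rewrite line0 derive1E; exact: derivableP.
have [dcomp vcomp] := @is_derive1_comp R phi line 0 _ _ dphi0 dline.
split; first exact: (derivable1P (phi \o f : _ -> R^o) x v).2.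
by rewrite derive_line.
Qed.

Lemma smooth_derive1 (phi : R -> R) : smooth phi -> smooth (derive1 phi).
Proof. by move=> sp n x; rewrite -derive1Sn; exact: sp. Qed.

Lemma Cs_at_comp s (phi : R -> R) f : smooth phi -> Cs_at s A f ->
  Cs_at s A (phi \o f : _ -> R^o).
Proof.
elim: s phi f => [|s IH] phi f sp sf; have cphi := smooth_continuous (n := 0) sp.
  apply: Cs_at0P => x Ax; apply: continuous_comp; first exact: (Cs_at_continuous sf).
  exact: cphi.
have sf' := Cs_atW sf; move/Cs_atSP : sf => [cf sf].
apply/Cs_atSP; split=> [x Ax|i].
  by apply: continuous_comp; [exact: cf|exact: cphi].
split=> [x Ax|]; first exact: (is_derive_comp1 ((sf i).1 _ Ax) (sp 0 _)).1.
apply: (@Cs_at_eq _ s ((derive1 phi \o f : _ -> R^o) * partial i f)) => [x Ax|].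
  by rewrite /partial (is_derive_comp1 ((sf i).1 _ Ax) (sp 0 _)).2.
apply: Cs_at_mul; last exact: (sf i).2.
exact: (IH _ _ (smooth_derive1 sp) sf').
Qed.

(** The bounds that are stable under the product and chain rules along l: these
    rules distribute the directions of l among the factors, keeping their
    order. *)
Definition partials_bounded l (M : R) f :=
  forall l' x, subseq l' l -> A x -> `|partials l' f x| <= M.

Lemma partials_bounded_sub l l' M f : subseq l' l ->
  partials_bounded l M f -> partials_bounded l' M f.
Proof. by move=> ll' fM l'' x h; apply: fM; exact: subseq_trans ll'. Qed.

Lemma partials_bounded_rcons l i M f : partials_bounded (rcons l i) M f ->
  partials_bounded l M (partial i f).
Proof.
move=> fM l' x h Ax; rewrite -partials_rcons; apply: fM => //.
by rewrite -!cats1 cat_subseq.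
Qed.

(** Leibniz' rule, with 2^n terms for n directions. *)
Lemma partials_mul_le l f g M N : 0 <= M -> 0 <= N ->
  Cs_at (size l) A f -> Cs_at (size l) A g ->
  partials_bounded l M f -> partials_bounded l N g ->
  forall x, A x -> `|partials l (f * g) x| <= 2 ^+ size l * (M * N).
Proof.
move=> M0 N0; elim/last_ind: l f g => [|l i IH] f g sf sg fM gN x Ax.
  by rewrite expr0 mul1r /= normrM ler_pM//; [exact: (fM [::])|exact: (gN [::])].
move: sf sg; rewrite size_rcons => sf sg.
have sf' := Cs_atW sf; have sg' := Cs_atW sg.
move/Cs_atSP : sf => [cf /(_ i)[df sf]]; move/Cs_atSP : sg => [cg /(_ i)[dg sg]].
have ll : subseq l (rcons l i) by exact: subseq_rcons.
have fM' := partials_bounded_sub ll fM; have gN' := partials_bounded_sub ll gN.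
have fM1 := partials_bounded_rcons fM; have gN1 := partials_bounded_rcons gN.
rewrite partials_rcons.
rewrite (@partials_eq _ _ (1 *: (f * partial i g) + partial i f * g))//; last first.
  by move=> y Ay; rewrite scale1r partial_mul//; [exact: df|exact: dg].
have sM1 := Cs_at_mul sf' sg; have sM2 := Cs_at_mul sf sg'.
rewrite (@partials_linear _ _ _ _ oA (size l) _ _ _ _ _ sM1 sM2)// scale1r.
rewrite (le_trans (ler_normD _ _))// exprS -mulrA mulr_natl mulr2n.
by rewrite lerD//; exact: IH.
Qed.

(** The innermost derivative of phi o f is (phi' o f) times a derivative of f, which
    reduces the bound to the product rule and to the case of phi' along a
    shorter list. The bound is linear in the size of phi, so that it tends
    to 0 with phi. *)
Lemma partials_comp_le (n : nat) (B : R) : 0 <= B -> exists2 C : R, 1 <= C &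
  forall l f phi delta, (size l <= n)%N -> smooth phi -> Cs_at (size l) A f ->
    partials_bounded l B f -> 0 <= delta ->
    (forall j t, (j <= n)%N -> `|t| <= B -> `|derive1n j phi t| <= delta) ->
    forall x, A x -> `|partials l (phi \o f : _ -> R^o) x| <= C * delta.
Proof.
move=> B0; elim: n => [|n [C C1 IH]].
  exists 1 => // l f phi delta; rewrite leqn0 size_eq0 => /eqP -> sp sf fB d0 pd x Ax.
  by rewrite mul1r /=; apply: (pd 0%N) => //; exact: (fB [::]).
have C0 : 0 <= C by rewrite (le_trans _ C1).
have T1 : (1 : R) <= 2 ^+ n by rewrite exprn_ege1// ler1n.
exists (C + 2 ^+ n * (C * B)); first by rewrite ler_wpDr// !mulr_ge0// exprn_ge0.
move=> l f phi delta; case/lastP: l => [|l i] ls sp sf fB d0 pd x Ax.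
  apply: (@le_trans _ _ delta); first by apply: (pd 0%N) => //; exact: (fB [::]).
  by rewrite ler_peMl// ler_wpDr// !mulr_ge0// exprn_ge0.
move: ls sf; rewrite size_rcons ltnS => ls sf.
have sf' := Cs_atW sf; move/Cs_atSP : sf => [cf /(_ i)[df sf]].
have ll : subseq l (rcons l i) by exact: subseq_rcons.
rewrite partials_rcons.
rewrite (@partials_eq _ _ ((derive1 phi \o f : _ -> R^o) * partial i f))//; last first.
  by move=> y Ay; rewrite /partial (is_derive_comp1 (df _ Ay) (sp 0 _)).2.
have sp' := smooth_derive1 sp.
have Cd : 0 <= C * delta by rewrite mulr_ge0.
apply: (@le_trans _ _ (2 ^+ size l * (C * delta * B))).
  have bphi : partials_bounded l (C * delta) (derive1 phi \o f : _ -> R^o).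
    move=> l' y ll' Ay; have sl' := size_subseq ll'.
    apply: (IH l' f (derive1 phi) delta (leq_trans sl' ls) sp' _ _ d0 _ y Ay).
    + exact: Cs_at_le sf'.
    + exact: partials_bounded_sub (subseq_trans ll' ll) fB.
    + by move=> j t jn tB; rewrite -derive1Sn; exact: pd.
  exact: (partials_mul_le Cd B0 (Cs_at_comp sp' sf') sf bphi
    (partials_bounded_rcons fB) Ax).
rewrite mulrDl ler_wpDl//.
rewrite -!mulrA [B * delta]mulrC; apply: ler_wpM2r.
  by rewrite !mulr_ge0.
by rewrite ler_eXn2l// ltr1n.
Qed.

(** Partial derivatives of vector-valued functions are computed by coordinates. *)
Lemma Cs_at_col s n (F : 'cV[R]_d -> 'cV[R]_n) :
  (forall a, Cs_at s A (fun x => F x a 0 : R^o)) ->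
  forall l, (size l <= s)%N -> forall x, A x ->
    partials l F x = \col_a partials l (fun x => F x a 0 : R^o) x.
Proof.
move=> sF; elim=> [|i l IH] ls x Ax /=; first by apply/colP => a; rewrite mxE.
have E : {near x, (fun y => \col_a partials l (fun x => F x a 0 : R^o) y) =1 partials l F}.
  by apply: near_eq_open => // y Ay; rewrite IH// ltnW.
have dF : derivable (fun y => \col_a partials l (fun x => F x a 0 : R^o) y) x (delta_mx i 0).
  apply/derivable_mxP => a j.
  rewrite (_ : (fun _ => _) = partials l (fun x => F x a 0 : R^o)).
    exact: ((sF a) l (ltnW ls)).2 ls i x Ax.
  by apply/funext => y; rewrite mxE.
rewrite /partial -(near_eq_derive _ E) derive_mx//.
apply/matrixP => a j; rewrite !mxE.
rewrite [in LHS](_ : (fun _ => _) = partials l (fun x => F x a 0 : R^o))//.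
by apply/funext => y; rewrite mxE.
Qed.

Lemma Cs_at_colP s n (F : 'cV[R]_d -> 'cV[R]_n) :
  (forall a, Cs_at s A (fun x => F x a 0 : R^o)) -> Cs_at s A F.
Proof.
move=> sF l ls; have E x : A x ->
    {near x, (fun y => \col_a partials l (fun x => F x a 0 : R^o) y) =1 partials l F}.
  by move=> Ax; apply: near_eq_open => // y Ay; rewrite (Cs_at_col sF).
split=> [x Ax|sl i x Ax].
  rewrite /prop_for /continuous_at (Cs_at_col sF)//.
  apply: cvg_trans (near_eq_cvg (E x Ax)) _.
  apply/cvgrPdist_le => e e0.
  have H : \forall y \near x, forall a, `|partials l (fun x => F x a 0 : R^o) x
      - partials l (fun x => F x a 0 : R^o) y| <= e.
    apply: (@filter_forall _ _ (fun a y =>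
      `|partials l (fun x => F x a 0 : R^o) x
        - partials l (fun x => F x a 0 : R^o) y| <= e) (nbhs x) _) => a.
    have ca := ((sF a) l ls).1 x Ax; move/cvgrPdist_le : ca => /(_ e e0) ca. exact: filterS ca.
  apply: filterS H => y Hy; apply: cV_norm_le => [|a]; first exact: ltW.
  by rewrite !mxE; exact: Hy.
apply: near_eq_derivable (E x Ax) _; apply/derivable_mxP => a j.
rewrite (_ : (fun _ => _) = partials l (fun x => F x a 0 : R^o)).
  exact: ((sF a) l ls).2 sl i x Ax.
by apply/funext => y; rewrite mxE.
Qed.

Lemma Cs_norm_col_le s n (F : 'cV[R]_d -> 'cV[R]_n) (M : R) : 0 <= M ->
  (forall a, Cs_at s A (fun x => F x a 0 : R^o)) ->
  (forall a alpha x, @order_le d s alpha -> A x ->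
     `|partials (multi_seq alpha) (fun x => F x a 0 : R^o) x| <= M) ->
  (Cs_norm s A F <= (M *+ #|{: multi_index d s}|)%:E)%E.
Proof.
move=> M0 sF FM; apply: Cs_norm_le => //; first exact: Cs_at_colP.
move=> alpha x oa Ax; rewrite (Cs_at_col sF)//; last exact: order_leP.
by apply: cV_norm_le => // a; rewrite mxE; exact: FM.
Qed.

End Cs_functions.

(** * Activations close to the identity *)

Section near_identity.
Context (R : realType) (sigma : R -> R).
Implicit Types (tau : R -> R) (a b c e w t B delta eta : R).
Hypothesis ss : smooth sigma.
Hypothesis np : non_polynomial sigma.

Definition affine_act (a b c e t : R) : R := a * sigma (b * t + c) + e.

(** A family containing t - affine_act a b c e t and closed under derivation. *)
Definition affine_act_lin (tau : R -> R) (a b c e w t : R) : R :=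
  a * tau (b * t + c) + (e + w * t).
Local Notation aff := affine_act_lin.

Lemma is_derive_aff tau a b c e w t : derivable tau (b * t + c) 1 ->
  is_derive t 1 (aff tau a b c e w) (a * b * derive1 tau (b * t + c) + w).
Proof.
move=> dtau.
have dlin (p q : R) : is_derive t (1 : R) (fun t => p * t + q) p.
  have := is_deriveD (is_deriveZ p (is_derive_id t 1)) (is_derive_cst q t 1).
  by rewrite addr0 /GRing.scale/= mulr1.
have dt : is_derive (b * t + c) 1 tau (derive1 tau (b * t + c)).
  by rewrite derive1E; exact: derivableP.
have dc := @is_derive1_comp R tau (fun t => b * t + c) t _ _ dt (dlin b c).
have dd := is_deriveD (is_deriveZ a dc) (dlin w e).
rewrite (_ : aff tau a b c e w = a *: (tau \o (fun t => b * t + c)) + (fun t => w * t + e)).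
  apply: (trigger_derive dd).
  by rewrite /GRing.scale/=; ring.
by apply/funext => z; rewrite /aff !fctE /= /GRing.scale/= [e + _]addrC.
Qed.

Lemma derive1_aff tau a b c e w : (forall t, derivable tau t 1) ->
  derive1 (aff tau a b c e w) = aff (derive1 tau) (a * b) b c w 0.
Proof.
move=> dtau; apply/funext => t; rewrite derive1E.
have H := is_derive_aff a e w (dtau (b * t + c)).
by rewrite derive_val /aff mul0r addr0.
Qed.

Lemma derive1n_aff n tau a b c e w : smooth tau ->
  derive1n n.+1 (aff tau a b c e w) =
  aff (derive1n n.+1 tau) (a * b ^+ n.+1) b c (if n is 0 then w else 0) 0.
Proof.
move=> st; elim: n => [|n IH].
  by rewrite expr1 !derive1n1 derive1_aff// => t; exact: (st 0%N t).
rewrite derive1nS IH derive1_aff; last exact: st.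
by rewrite -derive1nS [in RHS]exprSr mulrA.
Qed.

Lemma smooth_aff tau a b c e w : smooth tau -> smooth (aff tau a b c e w).
Proof.
move=> st [|n] x.
  exact: (@ex_derive _ _ _ _ _ _ _ (is_derive_aff _ _ _ (st 0%N _))).
rewrite derive1n_aff//.
exact: (@ex_derive _ _ _ _ _ _ _ (is_derive_aff _ _ _ (st n.+1 _))).
Qed.

Lemma smooth_affine_act a b c e : smooth (affine_act a b c e).
Proof.
rewrite (_ : affine_act a b c e = aff sigma a b c e 0); first exact: smooth_aff.
by apply/funext => t; rewrite /aff mul0r addr0.
Qed.

Lemma derive1n_bounded s B : exists2 C : R, 0 < C &
  forall j t, (j <= s)%N -> `|t| <= B -> `|derive1n j sigma t| <= C.
Proof.
elim: s => [|s [C C0 sC]].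
  have [C C0 sC] := continuous_bounded B (smooth_continuous (n := 0) ss).
  by exists C => // j t; rewrite leqn0 => /eqP ->; exact: sC.
have [D D0 sD] := continuous_bounded B (smooth_continuous (n := s.+1) ss).
exists (C + D); first by rewrite addr_gt0.
move=> j t; rewrite leq_eqVlt ltnS => /predU1P[->|js] tB.
  by rewrite (le_trans (sD _ tB))// lerDr ltW.
by rewrite (le_trans (sC _ _ js tB))// lerDl ltW.
Qed.

(** With sigma'(c) = m != 0, the choice a = 1 / (h m), b = h gives a difference
    quotient of sigma at c. The distance to the identity is O(h) in
    each derivative: by Taylor's formula for orders 0 and 1, and because the
    derivative of order j >= 2 carries a factor h^(j - 1). *)
Lemma near_identity s B delta : 0 < B -> 0 < delta -> exists a b c e : R,
  smooth (fun t => t - affine_act a b c e t) /\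
  forall j t, (j <= s)%N -> `|t| <= B ->
    `|derive1n j (fun t => t - affine_act a b c e t) t| <= delta.
Proof.
move=> B0 d0; have [c sc] := non_polynomial_derive1n 1 ss np.
set m := derive1n 1 sigma c in sc; have m0 : 0 < `|m| by rewrite normr_gt0.
pose B' := B + `|c|.
have [C0 C00 sC0] := smooth_taylor1 0 B' ss.
have [C1 C10 sC1] := smooth_lipschitz 1 B' ss.
have [C2 C20 sC2] := derive1n_bounded s B'.
have t0 : 0 <= C0 * B ^+ 2 by rewrite mulr_ge0 ?(ltW C00)// exprn_ge0// ltW.
have t1 : 0 <= C1 * B by rewrite mulr_ge0 ?(ltW C10)// ltW.
have t2 := ltW C20.
pose D := (C0 * B ^+ 2 + C1 * B + C2) / `|m|.
have D0 : 0 < D by rewrite divr_gt0// ltr_wpDl// addr_ge0.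
pose h := Num.min 1 (delta / D).
have h0 : 0 < h by rewrite lt_min ltr01 divr_gt0.
have h1 : h <= 1 by rewrite ge_min lexx.
have hD : h * D <= delta by rewrite -ler_pdivlMr// ge_min lexx orbT.
have hn : h != 0 by rewrite gt_eqF.
pose a := (h * m)^-1; exists a, h, c, (- (a * sigma c)).
have E : (fun t => t - affine_act a h c (- (a * sigma c)) t) =
    aff sigma (- a) h c (a * sigma c) 1.
  by apply/funext => t; rewrite /aff /affine_act; ring.
split; first by rewrite E; exact: smooth_aff.
move=> j t js tB; rewrite E; apply: le_trans hD.
have cB : `|c| <= B' by rewrite lerDr ltW.
have htB : `|h * t| <= B.
  by rewrite normrM gtr0_norm// (le_trans _ tB)// ler_piMl.
have ht : `|h * t + c| <= B' by rewrite (le_trans (ler_normD _ _))// lerD2r.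
have nD (x y : R) : `|x| <= h * y -> y <= C0 * B ^+ 2 + C1 * B + C2 ->
    `|x / m| <= h * D.
  move=> xy yD; rewrite normrM normfV /D mulrA ler_pM2r ?invr_gt0//.
  by rewrite (le_trans xy)// ler_pM2l.
case: j js => [|j] js.
  rewrite /= /aff (_ : _ + _ = - ((sigma (h * t + c) - sigma c - h * t * m) / h) / m); last first.
    by rewrite /a; field; rewrite hn sc.
  apply: (nD _ (C0 * B ^+ 2)); last by lra.
  rewrite normrN normrM normfV (gtr0_norm h0) ler_pdivrMr//.
  have := sC0 _ _ cB ht; rewrite /= addrK => /le_trans; apply.
  rewrite normrM exprMn (gtr0_norm h0).
  have : `|t| ^+ 2 <= B ^+ 2 by rewrite lerXn2r ?nnegrE ?(ltW B0).
  move=> tB2; rewrite (_ : h * _ * h = h ^+ 2 * (C0 * B ^+ 2)); last by ring.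
  by rewrite mulrCA ler_pM2l ?exprn_gt0// ler_pM2l.
rewrite derive1n_aff// /aff mul0r addr0.
case: j js => [|j] js.
  rewrite (_ : _ + _ = - (derive1n 1 sigma (h * t + c) - m) / m); last first.
    by rewrite /a expr1; field; rewrite hn sc.
  apply: (nD _ (C1 * B)); last by lra.
  rewrite normrN; have := sC1 _ _ cB ht; rewrite addrK => /le_trans; apply.
  by rewrite normrM (gtr0_norm h0) mulrCA ler_pM2l// ler_pM2l.
rewrite addr0 (_ : _ * _ = - (h ^+ j.+1 * derive1n j.+2 sigma (h * t + c)) / m); last first.
  by rewrite /a [h ^+ j.+2]exprS; field; rewrite hn sc.
apply: (nD _ C2); last by lra.
rewrite normrN normrM normrX (gtr0_norm h0) ler_pM ?exprn_ge0 ?(ltW h0)//; last exact: sC2.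
by rewrite exprS ler_piMr ?(ltW h0)// exprn_ile1// ltW.
Qed.

(** With phi := id - g small, f - g o g o f = phi o (g o f) + phi o f, and
    g o f = f - phi o f obeys the same bounds as f up to 1. *)
Lemma double_near_identity d (A : set 'cV[R]_d) s B eta : open A ->
  0 <= B -> 0 < eta -> exists a b c e : R,
  let g := affine_act a b c e in
  forall (f : 'cV[R]_d -> R^o), Cs_at s A f ->
    Cs_at s A (fun x => f x - g (g (f x)) : R^o) /\
    forall l, (size l <= s)%N -> partials_bounded A l B f ->
    forall x, A x -> `|partials l (fun x => f x - g (g (f x)) : R^o) x| <= eta.
Proof.
move=> oA B0 eta0; have B10 : 0 <= B + 1 by rewrite addr_ge0.
have B1 : 0 < B + 1 by rewrite ltr_wpDl.
have [C C1 HC] := partials_comp_le oA s B10.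
have C0 : 0 < C by rewrite (lt_le_trans ltr01).
pose delta := Num.min C^-1 (eta / 2 / C).
have d0 : 0 < delta by rewrite lt_min invr_gt0 C0 !divr_gt0.
have Cd1 : C * delta <= 1.
  by rewrite -ler_pdivlMl// mulr1 ge_min lexx.
have Cd2 : C * delta <= eta / 2.
  by rewrite -ler_pdivlMl// mulrC ge_min lexx orbT.
have [a [b [c [e]]]] := near_identity s B1 d0.
set g := affine_act a b c e; set phi := (fun t => t - g t) => -[sphi bphi].
exists a, b, c, e; rewrite /= -/g => f sf.
have sphif := Cs_at_comp oA sphi sf.
pose gf : 'cV[R]_d -> R^o := (-1) *: (phi \o f : _ -> R^o) + f.
have gfE x : gf x = g (f x).
  by rewrite /gf !fctE /= /phi /GRing.scale/=; ring.
have sgf : Cs_at s A gf := Cs_at_linear oA (-1) sphif sf.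
have sphigf := Cs_at_comp oA sphi sgf.
have E : (fun x => f x - g (g (f x)) : R^o) = 1 *: (phi \o gf : _ -> R^o) + (phi \o f : _ -> R^o).
  apply/funext => x; rewrite !fctE /= /phi !gfE /GRing.scale/=; ring.
split; first by rewrite E; exact: (Cs_at_linear oA 1 sphigf sphif).
move=> l ls fB.
have comp_le h l' x : subseq l' l -> Cs_at s A h -> partials_bounded A l (B + 1) h ->
    A x -> `|partials l' (phi \o h : _ -> R^o) x| <= C * delta.
  move=> ll' sh hB Ax; have ls' := leq_trans (size_subseq ll') ls.
  apply: (HC l' h phi delta ls' sphi (Cs_at_le ls' sh) _ (ltW d0) bphi x Ax).
  exact: partials_bounded_sub hB.
have fB1 : partials_bounded A l (B + 1) f.
  by move=> l' x ll' Ax; rewrite (le_trans (fB l' x ll' Ax))// lerDl.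
have gB1 : partials_bounded A l (B + 1) gf.
  move=> l' x ll' Ax; have ls' := leq_trans (size_subseq ll') ls.
  rewrite (partials_linear oA (-1) sphif sf ls' Ax) addrC.
  rewrite (le_trans (ler_normD _ _))// lerD ?fB//.
  by rewrite normrZ normrN1 mul1r (le_trans (comp_le f l' x ll' sf fB1 Ax)).
move=> x Ax; rewrite E (partials_linear oA 1 sphigf sphif ls Ax) scale1r.
rewrite (le_trans (ler_normD _ _))// [eta]splitr lerD//.
  by rewrite (le_trans _ Cd2)//; exact: comp_le.
by rewrite (le_trans _ Cd2)//; exact: comp_le.
Qed.

End near_identity.

(** * Linear features of C^s functions *)

Lemma lipschitz_le_continuous (R : realType) (V : normedModType R) (f : V -> R)
  (C : R) : (forall u v, `|f u - f v| <= C * `|u - v|) -> continuous f.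
Proof.
move=> fC u; apply/cvgrPdist_le => e e0; near=> v.
have C1 : 0 < `|C| + 1 by rewrite ltr_wpDl.
apply: (le_trans (fC _ _)); apply: (@le_trans _ _ ((`|C| + 1) * `|u - v|)).
  by rewrite ler_wpM2r// (le_trans (ler_norm _))// lerDl.
rewrite -ler_pdivlMl// mulrC; near: v.
by apply: cvgr_dist_le; [exact: cvg_id|rewrite divr_gt0].
Unshelve. all: by end_near. Qed.

Section features.
Context (R : realType) (d k : nat) (Omega : set 'cV[R]_d).
Hypothesis oO : open Omega.
Hypothesis bO : bounded_set Omega.
Local Notation integral f := (Rintegral (lebesgue d) Omega f).
Local Notation bc := (bounded_continuous Omega).
Implicit Types (psi : 'I_k -> 'cV[R]_d -> R) (u v : 'cV[R]_d -> 'cV[R]_k).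

Definition bounded_continuous_family psi := forall i, bc (psi i).
Definition bounded_continuous_vec v := forall i, bc (fun y => v y i 0).

Definition feature psi v : R := \sum_i integral (fun y => v y i 0 * psi i y).

Lemma bounded_continuous_vecB u v : bounded_continuous_vec u ->
  bounded_continuous_vec v -> bounded_continuous_vec (fun y => u y - v y).
Proof.
move=> bu bv i; rewrite (_ : (fun y => _) = fun y => (-1) * v y i 0 + u y i 0).
  exact: bounded_continuous_affine.
by apply/funext => y; rewrite !mxE mulN1r addrC.
Qed.

Lemma featureB psi u v : bounded_continuous_family psi ->
  bounded_continuous_vec u -> bounded_continuous_vec v ->
  feature psi (fun y => u y - v y) = feature psi u - feature psi v.
Proof.
move=> bp bu bv; rewrite /feature -sumrB; apply: eq_bigr => i _.
rewrite -[in RHS]mulN1r addrC -(Rintegral_affine oO bO).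
- by congr Rintegral; apply/funext => y; rewrite !mxE; ring.
- exact: bounded_continuousM.
- exact: bounded_continuousM.
Qed.

Lemma feature_affine a psi1 psi2 v : bounded_continuous_family psi1 ->
  bounded_continuous_family psi2 -> bounded_continuous_vec v ->
  feature (fun i y => a * psi1 i y + psi2 i y) v =
    a * feature psi1 v + feature psi2 v.
Proof.
move=> b1 b2 bv; rewrite /feature mulr_sumr -big_split; apply: eq_bigr => i _ /=.
rewrite -(Rintegral_affine oO bO).
- by congr Rintegral; apply/funext => y; ring.
- exact: bounded_continuousM.
- exact: bounded_continuousM.
Qed.

Lemma feature_le psi : bounded_continuous_family psi -> exists2 C : R, 0 <= C &
  forall v M, 0 <= M -> bounded_continuous_vec v ->
    (forall x i, Omega x -> `|v x i 0| <= M) -> `|feature psi v| <= C * M.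
Proof.
move=> bp.
have /choice[N NP] : forall i, exists N, 0 <= N /\ forall x, Omega x -> `|psi i x| <= N.
  move=> i; have [_ [N NP]] := bp i; exists `|N|; split=> // x Ox.
  by rewrite (le_trans (NP _ Ox))// ler_norm.
pose mu := fine (lebesgue d Omega); have mu0 : 0 <= mu by exact: fine_ge0.
exists (\sum_i N i * mu).
  by apply: sumr_ge0 => i _; rewrite mulr_ge0//; exact: (NP i).1.
move=> v M M0 bv vM; rewrite /feature (le_trans (ler_norm_sum _ _ _))// mulr_suml.
apply: ler_sum => i _; have [N0 psN] := NP i.
rewrite mulrAC; apply: le_Rintegral_abs => //; first exact: bounded_continuousM.
by move=> x Ox; rewrite normrM mulrC ler_pM// ?psN// vM.
Qed.

Section on_Cs_space.
Variable s : nat.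
Local Notation U := (Cs_space oO s 'cV[R]_k).

Lemma Cs_space_normE (u : U) : `|u| = fine (Cs_norm s Omega u).
Proof. by []. Qed.

Lemma Cs_space_le_norm (u : U) x : Omega x -> `|u x| <= `|u|.
Proof.
move=> Ox; rewrite Cs_space_normE.
pose a0 : multi_index d s := [ffun=> ord0].
have oa : order_le a0 by rewrite /order_le big1// => i _; rewrite ffunE.
apply: (Cs_norm_ge_partials (l := [::]) (Cs_spaceP u).1 oa) => //.
exact: sub0seq.
Qed.

Lemma Cs_space_bounded_continuous (u : U) : bounded_continuous_vec u.
Proof.
move=> i; split=> [x Ox|].
  have cu := Cs_at_continuous (Cs_norm_fin (Cs_spaceP u).1) Ox.
  exact: (@continuous_comp _ _ _ u (fun z : 'cV[R]_k => z i 0 : R) x cu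
    (@coord_continuous _ _ _ i 0 (u x))).
by exists `|u| => x Ox; rewrite (le_trans (cV_norm_ge _ _))// Cs_space_le_norm.
Qed.

Lemma Cs_spaceB (u v : U) x : (u - v) x = u x - v x.
Proof. by []. Qed.

Lemma feature_continuous psi : bounded_continuous_family psi ->
  continuous (fun u : U => feature psi u).
Proof.
move=> bp; have [C C0 CP] := feature_le bp.
apply: (lipschitz_le_continuous (C := C)) => u v.
rewrite -featureB//; [|exact: Cs_space_bounded_continuous..].
apply: CP => //; first by apply: bounded_continuous_vecB; exact: Cs_space_bounded_continuous.
by move=> x i Ox; rewrite (le_trans (cV_norm_ge _ _))// (Cs_space_le_norm (u - v)).
Qed.

(** Use u - v itself as the test function. *)
Lemma feature_separates (u v : U) : u <> v ->
  exists psi, bounded_continuous_family psi /\ feature psi u <> feature psi v.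
Proof.
move=> uv; pose psi i y := (u - v) y i 0.
have bp : bounded_continuous_family psi by exact: (Cs_space_bounded_continuous (u - v)).
exists psi; split => // /eqP; rewrite -subr_eq0 -featureB//;
  [|exact: Cs_space_bounded_continuous..].
rewrite psumr_eq0 => [/allP/= H|i _]; last first.
  by apply: Rintegral_ge0 => y _; rewrite -expr2 sqr_ge0.
apply: uv; apply/val_inj/funext => x /=.
have [Ox|nOx] := pselect (Omega x); last by rewrite !(Cs_spaceP _).2.
apply/colP => i; apply/eqP; rewrite -subr_eq0.
have /eqP I0 := H i (mem_index_enum i).
by have := Rintegral_sqr_eq0 oO bO (bp i) I0 Ox; rewrite /psi Cs_spaceB !mxE => ->.
Qed.

End on_Cs_space.
End features.

(** * A nonlocal neural operator with two hidden layers *)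

(** All layers of an operator have the same width. A layer that needs n channels
    occupies the first n of them and is 0 on the others. *)
Section padding.
Context (R : realType) (dc : nat).

Definition pad n : 'M[R]_(dc, n) := pid_mx n.
Definition unpad n : 'M[R]_(n, dc) := pid_mx n.

Lemma unpadE n (ndc : (n <= dc)%N) (v : 'cV[R]_dc) i :
  (unpad n *m v) i 0 = v (widen_ord ndc i) 0.
Proof.
rewrite mxE (bigD1 (widen_ord ndc i))//= big1 ?addr0.
  by rewrite mxE/= eqxx ltn_ord mul1r.
move=> j ji; rewrite mxE (_ : (_ == _) = false) ?mul0r//.
by apply/negbTE; apply: contra ji => /eqP ij; apply/eqP/val_inj.
Qed.

Lemma padE n (v : 'cV[R]_n) i :
  (pad n *m v) i 0 = if (i < n)%N =P true is ReflectT h then v (Ordinal h) 0 else 0.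
Proof.
rewrite mxE; case: eqP => [h|/negP nh].
  rewrite (bigD1 (Ordinal h))//= big1 ?addr0 => [|j ji].
    by rewrite mxE/= eqxx h mul1r.
  rewrite mxE (_ : (_ == _) = false) ?mul0r//.
  by apply/negbTE; apply: contra ji => /eqP ij; apply/eqP/val_inj.
by rewrite big1// => j _; rewrite mxE (negbTE nh) andbF mul0r.
Qed.

Lemma pad_widen n (ndc : (n <= dc)%N) (v : 'cV[R]_n) i :
  (pad n *m v) (widen_ord ndc i) 0 = v i 0.
Proof.
rewrite padE /=; case: eqP => [h|/(_ (ltn_ord i))//].
by congr (v _ _); apply: val_inj.
Qed.

Lemma unpad_pad n : (n <= dc)%N -> unpad n *m pad n = 1%:M.
Proof.
by move=> ndc; rewrite /unpad /pad mul_pid_mx minnn (minn_idPr ndc) pid_mx_1.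
Qed.

(** The channels outside the first n stay 0 because sigma 0 = 0. *)
Lemma map_pad (sigma : R -> R) n (v : 'cV[R]_n) : sigma 0 = 0 ->
  map_mx sigma (pad n *m v) = pad n *m map_mx sigma v.
Proof.
move=> s0; apply/colP => i; rewrite mxE !padE; case: eqP => // h.
by rewrite mxE.
Qed.

End padding.

Section bounded_continuous_more.
Context (R : realType) (d : nat) (Omega : set 'cV[R]_d).

Lemma bounded_continuous_comp (h : R -> R) f : continuous h ->
  bounded_continuous Omega f -> bounded_continuous Omega (fun x => h (f x)).
Proof.
move=> ch [cf [M fM]]; split=> [x Ox|].
  exact: (@continuous_comp _ _ _ f h x (cf x Ox) (ch (f x))).
have [C C0 hC] := continuous_bounded M ch; exists C => x Ox; exact/hC/fM.
Qed.

Lemma bounded_continuous_mulmx m n (M : 'M[R]_(m, n)) (w : 'cV[R]_d -> 'cV[R]_n) :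
  bounded_continuous_vec Omega w -> bounded_continuous_vec Omega (fun x => M *m w x).
Proof.
move=> bw i; rewrite (_ : (fun y => _) = fun y => \sum_j M i j * w y j 0); last first.
  by apply/funext => y; rewrite mxE.
elim: (index_enum _) => [|j r IH].
  rewrite (_ : (fun y => _) = fun=> 0); first exact: bounded_continuous_cst.
  by apply/funext => y; rewrite big_nil.
rewrite (_ : (fun y => _) = fun y => M i j * w y j 0 + \sum_(j <- r) M i j * w y j 0).
  exact: bounded_continuous_affine.
by apply/funext => y; rewrite big_cons.
Qed.

Lemma bounded_continuous_map (h : R -> R) n (w : 'cV[R]_d -> 'cV[R]_n) :
  continuous h -> bounded_continuous_vec Omega w ->
  bounded_continuous_vec Omega (fun x => map_mx h (w x)).
Proof.
move=> ch bw i; rewrite (_ : (fun y => _) = fun y => h (w y i 0)).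
  exact: bounded_continuous_comp.
by apply/funext => y; rewrite mxE.
Qed.

End bounded_continuous_more.

Section operator.
Context (R : realType) (sigma : R -> R) (d k k' : nat) (Omega : set 'cV[R]_d).
Hypotheses (oO : open Omega) (bO : bounded_set Omega) (O0 : Omega !=set0).
Hypotheses (s0 : sigma 0 = 0) (ss : smooth sigma).
Variables (a1 b1 c1 e1 a b c e : R) (p J : nat).
Variables (psi : 'I_p -> 'I_k -> 'cV[R]_d -> R) (bias : 'I_p -> R).
Variables (W : 'I_p -> 'I_J * 'I_k' -> R) (xi : nat -> 'cV[R]_d -> R).
Hypothesis bpsi : forall i, bounded_continuous_family Omega (psi i).

Local Notation g1 := (affine_act sigma a1 b1 c1 e1).
Local Notation g := (affine_act sigma a b c e).
Let dc := (k + (p + k'))%N.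
Let mu := fine (lebesgue d Omega).

Let kdc : (k <= dc)%N. Proof. exact: leq_addr. Qed.
Let pdc : (p <= dc)%N. Proof. by rewrite /dc addnCA leq_addr. Qed.
Let kdc' : (k' <= dc)%N. Proof. by rewrite /dc addnA leq_addl. Qed.

(** The neurons see u only after the lift, that is, through g1. *)
Definition neuron (u : 'cV[R]_d -> 'cV[R]_k) (i : 'I_p) : R :=
  sigma (feature Omega (psi i) (fun y => map_mx g1 (u y)) + bias i).

Definition coefficient u (x : 'I_J * 'I_k') : R := \sum_i W i x * neuron u i.

Definition operator_lift (z : 'cV[R]_(k + d)) : 'cV[R]_dc :=
  pad R dc k *m map_mx g1 (usubmx z).

(** With v = sigma (b z + c) in the first k' channels, a v + e is g z. *)
Definition operator_proj (v : 'cV[R]_dc) : 'cV[R]_k' :=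
  map_mx (fun t => g (a * t + e)) (unpad R dc k' *m v).

Lemma operator_liftP : feedforward sigma operator_lift.
Proof.
exists k, (fun z => map_mx sigma ((b1 *: row_mx 1%:M 0) *m z + const_mx c1)),
  (a1 *: pad R dc k), (pad R dc k *m const_mx e1).
split; first exact: first_hidden.
move=> z; rewrite /operator_lift -scalemxAl scalemxAr -mulmxDr; congr (_ *m _).
have -> : (b1 *: row_mx 1%:M 0) *m z = b1 *: usubmx z.
  by rewrite -{1}[z]vsubmxK -scalemxAl mul_row_col mul1mx mul0mx addr0.
by apply/colP => i; rewrite !mxE.
Qed.

Lemma operator_projP : feedforward sigma operator_proj.
Proof.
exists k', (fun v => map_mx sigma (((b * a) *: unpad R dc k') *m v + const_mx (b * e + c))),
  (a%:M), (const_mx e).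
split; first exact: first_hidden.
move=> v; rewrite mul_scalar_mx -scalemxAl.
rewrite /operator_proj; apply/colP => i; move: (unpad R dc k' *m v) => w; rewrite !mxE /affine_act.
by rewrite mulrDr mulrA addrA.
Qed.

Let Mt := ('I_p * 'I_k + 'I_J)%type.
Let M := #|{: Mt}|.

(** The integral against [psi i l] feeds coordinate l of the input into neuron i.
    The indices in 'I_J carry weight 0; they align the number of basis
    pairs with that of the next layer and supply the constant pair (1, 1). *)
Definition feature_layer : nno_layer R d dc M := NnoLayer 0
  (pad R dc p *m \col_i bias i)
  (fun m => if enum_val m is inl (i, l) then
     pad R dc p *m delta_mx i l *m unpad R dc k else 0)
  (fun m => if enum_val m is inl (i, l) then psi i l else fun=> 1)
  (fun m => fun=> 1).

(** The input is constant in x, so its integral against 1 is mu times its value;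
    the weights are divided by mu accordingly. *)
Definition output_layer : nno_layer R d dc M := NnoLayer 0
  (pad R dc k' *m const_mx c)
  (fun m => if enum_val m is inr j then
     pad R dc k' *m ((b / mu) *: \matrix_(l, i) W i (j, l)) *m unpad R dc p else 0)
  (fun m => fun=> 1)
  (fun m => if enum_val m is inr j then xi j else fun=> 1).

Definition operator : nno sigma d k k' := @Nno R sigma d k k' dc 2 M
  operator_lift operator_proj (fun l => if l is 0 then feature_layer else output_layer)
  operator_liftP operator_projP.

Lemma unpad_L2_inner n (w : 'cV[R]_d -> 'cV[R]_n) f : (n <= dc)%N ->
  unpad R dc n *m L2_inner Omega (fun y => pad R dc n *m w y) f = L2_inner Omega w f.
Proof.
move=> ndc; apply/colP => i; rewrite (unpadE ndc) !mxE.
by congr Rintegral; apply/funext => y; rewrite pad_widen.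
Qed.

Lemma sum_enum_val (V : nmodType) (F : Mt -> V) :
  \sum_(m < M) F (enum_val m) =
  (\sum_(x : 'I_p * 'I_k) F (inl x)) + \sum_j F (inr j).
Proof.
by rewrite -(big_enum_val F) big_sumType/=; congr (_ + _); apply: eq_bigl => x; rewrite inE.
Qed.

Lemma feature_layerE u : layer_map sigma Omega feature_layer
    (fun y => pad R dc k *m map_mx g1 (u y)) =
  fun=> pad R dc p *m \col_i neuron u i.
Proof.
apply/funext => x; rewrite /layer_map /= mul0mx add0r.
pose F (t : Mt) := if t is inl (i, l) then pad R dc p *m (delta_mx i l *m
  L2_inner Omega (fun y => map_mx g1 (u y)) (psi i l)) else 0.
rewrite (eq_bigr (fun m => F (enum_val m))).
  rewrite sum_enum_val [X in _ + (_ + X)]big1// addr0.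
  rewrite (eq_bigr (fun t => pad R dc p *m (delta_mx t.1 t.2 *m
    L2_inner Omega (fun y => map_mx g1 (u y)) (psi t.1 t.2)))); last by case.
  rewrite -mulmx_sumr -mulmxDr map_pad//; congr (_ *m _).
  apply/colP => i; rewrite mxE [RHS]mxE /neuron; congr sigma.
  rewrite mxE addrC mxE; congr (_ + _); rewrite summxE.
  rewrite -(pair_bigA _ (fun i' l => (delta_mx i' l *m
    L2_inner Omega (fun y => map_mx g1 (u y)) (psi i' l)) i 0))/= (bigD1 i)//=.
  rewrite [X in _ + X]big1 ?addr0 => [|i' ii']; last first.
    apply: big1 => l _; rewrite mxE big1// => l' _.
    by rewrite mxE eq_sym (negbTE ii') mul0r.
  apply: eq_bigr => l _; rewrite mxE (bigD1 l)//= big1 ?addr0.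
    by rewrite mxE !eqxx mul1r mxE.
  by move=> l' l'l; rewrite mxE (negbTE l'l) andbF mul0r.
move=> m _; rewrite scale1r /F; case: (enum_val m) => [[i l]|j].
  by rewrite -!mulmxA unpad_L2_inner.
by rewrite mul0mx.
Qed.

Lemma output_layerE u x : layer_map sigma Omega output_layer
    (fun=> pad R dc p *m \col_i neuron u i) x =
  pad R dc k' *m map_mx sigma (\col_l (b * (\sum_(j < J) xi j x * coefficient u (j, l)) + c)).
Proof.
rewrite /layer_map /= mul0mx add0r -map_pad//; congr map_mx.
have mu0 : mu != 0 by rewrite gt_eqF// fine_lebesgue_gt0.
pose F (t : Mt) := if t is inr j then
  xi j x *: (pad R dc k' *m (b *: (\matrix_(l, i) W i (j, l) *m \col_i neuron u i)))
  else 0.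
rewrite (eq_bigr (fun m => F (enum_val m))).
  rewrite sum_enum_val [X in _ + (X + _)]big1// add0r.
  rewrite /F; under eq_bigr do rewrite scalemxAr.
  rewrite -mulmx_sumr -mulmxDr; congr (_ *m _).
  apply/colP => l; rewrite mxE [RHS]mxE addrC mxE; congr (_ + _).
  rewrite summxE mulr_sumr; apply: eq_bigr => j _; rewrite !mxE mulrCA.
  by congr (_ * (_ * _)); apply: eq_bigr => i _; rewrite !mxE.
move=> m _; rewrite /F; case: (enum_val m) => [_|j]; first by rewrite mul0mx scaler0.
rewrite -!mulmxA unpad_L2_inner//.
have -> : L2_inner Omega (fun=> \col_i neuron u i) (fun=> 1) = mu *: \col_i neuron u i.
  apply/colP => i; rewrite !mxE.
  rewrite (_ : (fun _ => _) = fun=> neuron u i); last by apply/funext => y; rewrite mulr1.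
  by rewrite Rintegral_cst_domain// mulrC.
by rewrite -scalemxAr -scalemxAl scalerA mulrC divfK.
Qed.

Lemma operator_hidden0 u : nno_hidden Omega operator u 0 =
  fun y => pad R dc k *m map_mx g1 (u y).
Proof. by apply/funext => y; rewrite /= /operator_lift col_mxKu. Qed.

Lemma operator_hidden1 u : nno_hidden Omega operator u 1 =
  fun=> pad R dc p *m \col_i neuron u i.
Proof. by rewrite -feature_layerE -operator_hidden0. Qed.

Lemma operatorE u x : nno_eval Omega operator u x =
  \col_l g (g (\sum_(j < J) xi j x * coefficient u (j, l))).
Proof.
rewrite /nno_eval.
have -> : nno_hidden Omega operator u 2 x = layer_map sigma Omega output_layer
    (nno_hidden Omega operator u 1) x by [].
rewrite operator_hidden1 output_layerE /= /operator_proj mulmxA unpad_pad// mul1mx.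
by apply/colP => l; rewrite !mxE.
Qed.

Lemma operator_defined u : bounded_continuous_vec Omega u ->
  nno_defined Omega operator u.
Proof.
move=> bu [|[|//]] m _ i; apply: (bounded_continuous_integrable oO bO).
  rewrite operator_hidden0; apply: bounded_continuousM.
    have cg : continuous g1 := smooth_continuous (n := 0)
      (smooth_affine_act ss (a := a1) (b := b1) (c := c1) (e := e1)).
    exact: (bounded_continuous_mulmx _ (bounded_continuous_map cg bu)).
  rewrite /=; case: (enum_val m) => [[i' l]|j]; first exact: bpsi.
  exact: bounded_continuous_cst.
rewrite operator_hidden1; apply: bounded_continuousM; exact: bounded_continuous_cst.
Qed.

Lemma cst1_admissible : admissible_basis Omega (fun=> 1).
Proof.
split.
- rewrite /vanishes_only_on_null (_ : _ `&` _ = set0); first exact: negligible_set0.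
  by apply/seteqP; split => x // -[_ /=] /eqP; rewrite oner_eq0.
- by exists 1; split => // N N1 x _; rewrite normr1 ltW.
- by apply: continuous_subspaceT => x; exact: cst_continuous.
Qed.

End operator.

Section operator_structure.
Context (R : realType) (sigma : R -> R) (d k k' : nat) (Omega : set 'cV[R]_d).
Variables (a1 b1 c1 e1 a b c e : R) (p J : nat).
Variables (psi : 'I_p -> 'I_k -> 'cV[R]_d -> R) (bias : 'I_p -> R).
Variables (W : 'I_p -> 'I_J * 'I_k' -> R) (xi : nat -> 'cV[R]_d -> R).
Hypothesis J0 : (0 < J)%N.
Local Notation Psi := (operator sigma Omega a1 b1 c1 e1 a b c e psi bias W xi).

Lemma operator_output_basis : exists L, nno_depth Psi = L.+1 /\
  exists J, (0 < J)%N /\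
    (forall j, (j < J)%N -> exists m,
       {in Omega, nno_phi (nno_layers Psi L) m =1 xi j}) /\
    (forall j m, (j < J)%N ->
       {in Omega, nno_phi (nno_layers Psi L) m =1 xi j} ->
       admissible_basis Omega (nno_psi (nno_layers Psi L) m)).
Proof.
exists 1%N; split => //; exists J; split => //; split=> [j jJ|j m _ _].
  exists (enum_rank (inr (Ordinal jJ))) => x _ /=.
  by rewrite enum_rankK.
exact: cst1_admissible.
Qed.

Lemma operator_earlier_basis : exists l m, (l.+1 < nno_depth Psi)%N /\
  let eta1 := nno_psi (nno_layers Psi l) m in
  let eta2 := nno_phi (nno_layers Psi l) m in
  [/\ forall x, Omega x -> 0 <= eta1 x,
      admissible_basis Omega eta1 & admissible_basis Omega eta2].
Proof.
exists 0%N, (enum_rank (inr (Ordinal J0))); split => //=.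
rewrite enum_rankK; split; first by move=> x _; exact: ler01.
  exact: cst1_admissible.
exact: cst1_admissible.
Qed.

End operator_structure.

(** * Approximation of the coefficients *)

Section coefficient_approximation.
Context (R : realType) (sigma : R -> R) (d k s : nat) (Omega : set 'cV[R]_d).
Hypotheses (oO : open Omega) (bO : bounded_set Omega).
Hypotheses (ss : smooth sigma) (np : non_polynomial sigma).
Local Notation U := (Cs_space oO s 'cV[R]_k).
Variable K : set U.
Hypothesis cK : compact K.

Lemma norm_bounded_on_compact : exists2 r : R, 0 < r & forall u, K u -> `|u| <= r.
Proof.
have cn : continuous (fun u : U => `|u|) := @norm_continuous _ U.
have [M M0 KM] := compact_within_bounded cK (continuous_subspaceT cn).
by exists M => // u /KM; rewrite normr_id.
Qed.

(** Approximate F by shallow networks in exact features, then replace u by its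
    lift g1 u: features are Lipschitz for the sup norm and sigma is Lipschitz on
    bounded sets, so the error is at most h S with S independent of the
    closeness h of g1 to the identity. *)
Lemma coefficient_approx J k' (F : 'I_J * 'I_k' -> U -> R) (eta : R) :
  (forall x, {within K, continuous (F x)}) -> 0 < eta ->
  exists a1 b1 c1 e1 p (psi : 'I_p -> 'I_k -> 'cV[R]_d -> R) (bias : 'I_p -> R)
    (W : 'I_p -> 'I_J * 'I_k' -> R),
    (forall i, bounded_continuous_family Omega (psi i)) /\
    forall x u, K u ->
      `|F x u - coefficient sigma Omega a1 b1 c1 e1 psi bias W u x| <= eta.
Proof.
move=> cF eta0.
pose T := {psi : 'I_k -> 'cV[R]_d -> R | bounded_continuous_family Omega psi}.
pose ev (t : T) (u : U) := feature Omega (sval t) u.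
have ev_cont t : {within K, continuous (ev t)}.
  by apply: continuous_subspaceT; apply: feature_continuous => //; exact: (svalP t).
have ev_lin (a : R) t1 t2 : exists t, forall u, K u -> ev t u = a * ev t1 u + ev t2 u.
  have bt : bounded_continuous_family Omega (fun i y => a * sval t1 i y + sval t2 i y).
    by move=> i; apply: bounded_continuous_affine; [exact: (svalP t1)|exact: (svalP t2)].
  exists (exist _ _ bt) => u _; rewrite /ev /= feature_affine//.
  - exact: (svalP t1).
  - exact: (svalP t2).
  - exact: Cs_space_bounded_continuous.
have t0 : T.
  exists (fun _ _ => 0) => i; exact: bounded_continuous_cst.
have ev_sep u v : K u -> K v -> u <> v -> exists t, ev t u <> ev t v.
  by move=> _ _ /(feature_separates bO)[psi [bp uv]]; exists (exist _ _ bp).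
have e20 : 0 < eta / 2 by rewrite divr_gt0.
have [p [W [t [b Wb]]]] :=
  shallow_dense_family cK ev_cont ev_lin t0 ev_sep ss np cF e20.
have [r r0 Kr] := norm_bounded_on_compact.
have /choice[C CP] : forall i, exists C : R, 0 <= C /\
    forall v M, 0 <= M -> bounded_continuous_vec Omega v ->
    (forall x i, Omega x -> `|v x i 0| <= M) -> `|feature Omega (sval (t i)) v| <= C * M.
  by move=> i; have [C C0 H] := feature_le oO bO (svalP (t i)); exists C.
have /choice[D DP] : forall i, exists D : R, 0 <= D /\ forall x y,
    `|x| <= C i * (r + 1) + `|b i| -> `|y| <= C i * (r + 1) + `|b i| ->
    `|sigma y - sigma x| <= D * `|y - x|.
  move=> i; have [D D0 H] := smooth_lipschitz 0 (C i * (r + 1) + `|b i|) ss.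
  by exists D; split; [exact: ltW|exact: H].
pose S := \sum_x \sum_i `|W i x| * (D i * C i).
have S0' x : 0 <= \sum_i `|W i x| * (D i * C i).
  by apply: sumr_ge0 => i _; rewrite !mulr_ge0// ?(DP i).1 ?(CP i).1.
have S0 : 0 <= S by apply: sumr_ge0 => x _.
have S1 : 0 < S + 1 by rewrite ltr_wpDl.
pose h := Num.min 1 (eta / 2 / (S + 1)).
have h0 : 0 < h by rewrite lt_min ltr01 divr_gt0.
have h1 : h <= 1 by rewrite ge_min lexx.
have [a1 [b1 [c1 [e1 [_ gh]]]]] := near_identity ss np 0 r0 h0.
exists a1, b1, c1, e1, p, (fun i => sval (t i)), b, W; split=> [i|x u Ku].
  exact: (svalP (t i)).
rewrite [leRHS]splitr (le_trans (ler_distD (\sum_(i < p) W i x * sigma (ev (t i) u + b i)) _ _))//.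
rewrite lerD ?Wb// /coefficient -sumrB (le_trans (ler_norm_sum _ _ _))//.
set g1 := affine_act sigma a1 b1 c1 e1.
pose ut := fun y => map_mx g1 (u y).
have bu := Cs_space_bounded_continuous u.
have cg1 : continuous g1 :=
  smooth_continuous (n := 0) (smooth_affine_act ss (a := a1) (b := b1) (c := c1) (e := e1)).
have but : bounded_continuous_vec Omega ut := bounded_continuous_map cg1 bu.
have ur y i : Omega y -> `|u y i 0| <= r.
  move=> Oy; rewrite (le_trans (cV_norm_ge _ _))//.
  by rewrite (le_trans (Cs_space_le_norm u Oy))// Kr.
have uut y i : Omega y -> `|u y i 0 - ut y i 0| <= h.
  by move=> Oy; rewrite mxE; exact: (gh 0%N _ isT (ur y i Oy)).
have dif i : `|W i x * sigma (ev (t i) u + b i) - W i x * neuron sigma Omega a1 b1 c1 e1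
      (fun i => sval (t i)) b u i| <= h * (`|W i x| * (D i * C i)).
  have [C0 CiP] := CP i; have [D0 DiP] := DP i.
  rewrite -mulrBr normrM mulrCA ler_wpM2l// /neuron -/g1 -/ut.
  have fu : `|ev (t i) u| <= C i * (r + 1).
    apply: CiP => // [|y j Oy]; first by rewrite addr_ge0 ?(ltW r0).
    by rewrite (le_trans (ur y j Oy))// lerDl.
  have fut : `|feature Omega (sval (t i)) ut| <= C i * (r + 1).
    apply: CiP => // [|y j Oy]; first by rewrite addr_ge0 ?(ltW r0).
    rewrite -(subKr (u y j 0) (ut y j 0)) (le_trans (ler_normB _ _))//.
    by rewrite lerD ?ur// (le_trans (uut y j Oy)).
  apply: (le_trans (DiP _ _ _ _)).
  - by rewrite (le_trans (ler_normD _ _))// lerD2r.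
  - by rewrite (le_trans (ler_normD _ _))// lerD2r.
  rewrite [leRHS]mulrCA ler_wpM2l// [h * _]mulrC opprD addrACA subrr addr0.
  rewrite /ev -featureB//; last exact: (svalP (t i)).
  apply: CiP; rewrite ?(ltW h0)//; first exact: bounded_continuous_vecB.
  by move=> y j Oy; have := uut y j Oy; rewrite !mxE.
apply: (le_trans (ler_sum _ (fun i _ => dif i))); rewrite -mulr_sumr.
apply: (@le_trans _ _ (h * (S + 1))).
  rewrite ler_wpM2l ?(ltW h0)// ler_wpDr// /S (bigD1 x)//= lerDl.
  by apply: sumr_ge0 => y _.
by rewrite -ler_pdivlMr// ge_min lexx orbT.
Qed.

End coefficient_approximation.

(** * The approximation theorem *)

Section basis_combinations.
Context (R : realType) (d s : nat) (A : set 'cV[R]_d).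
Hypothesis oA : open A.
Variable xi : nat -> 'cV[R]_d -> R.
Hypothesis xi_Cs : forall j, (Cs_norm s A (xi j : _ -> R^o) < +oo)%E.

Definition combination J (w : 'I_J -> R) : 'cV[R]_d -> R^o :=
  fun x => \sum_(j < J) xi j x * w j.

Definition basis_norm j := fine (Cs_norm s A (xi j : _ -> R^o)).

Lemma basis_norm_ge0 j : 0 <= basis_norm j.
Proof. by apply: fine_ge0; exact: Cs_norm_ge0. Qed.

(** A subsequence of a multi-index is a multi-index, so the norms of the xi j
    control all the derivatives involved. *)
Lemma combination_le J (w : 'I_J -> R) : Cs_at s A (combination w) /\
  forall alpha l, @order_le d s alpha -> subseq l (multi_seq alpha) ->
  forall x, A x -> `|partials l (combination w) x| <= \sum_j `|w j| * basis_norm j.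
Proof.
rewrite /combination; elim: (index_enum _) => [|j r [sr IH]].
  rewrite (_ : (fun x => _) = (0 : 'cV[R]_d -> R^o)); last first.
    by apply/funext => x; rewrite big_nil.
  split; first exact: Cs_at0.
  by move=> alpha l _ _ x Ax; rewrite partials0 normr0 big_nil.
set h := (fun x => \sum_(j <- r) xi j x * w j) in sr IH *.
have sj : Cs_at s A (xi j : _ -> R^o) := Cs_norm_fin (xi_Cs j).
rewrite (_ : (fun x => _) = w j *: (xi j : _ -> R^o) + (h : _ -> R^o)); last first.
  by apply/funext => x; rewrite big_cons !fctE /h mulrC.
split; first exact: (Cs_at_linear oA (w j) sj sr).
move=> alpha l oa la x Ax.
have ls : (size l <= s)%N := leq_trans (size_subseq la) (order_leP oa).
rewrite (partials_linear oA (w j) sj sr ls Ax) big_cons.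
rewrite (le_trans (ler_normD _ _))// lerD//; last exact: (IH alpha).
by rewrite normrM ler_wpM2l//; exact: (Cs_norm_ge_partials (xi_Cs j) oa la).
Qed.

End basis_combinations.

Theorem theorem3p5 (R : realType) (d k k' s s' : nat) (d_gt0 : (0 < d)%N)
    (Omega : set 'cV[R]_d) (oOmega : open Omega) (Omega0 : Omega !=set0)
    (cOmega : connected Omega) (bOmega : bounded_set Omega)
    (lOmega : lipschitz_boundary Omega)
    (PsiD : Cs_space oOmega s 'cV[R]_k -> Cs_space oOmega s' 'cV[R]_k')
    (PsiD_maps : forall u, Cs_closure u -> Cs_closure (PsiD u))
    (PsiD_cont : {within @Cs_closure R d Omega oOmega s 'cV[R]_k,
                    continuous PsiD})
    (K : set (Cs_space oOmega s 'cV[R]_k))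
    (K_sub : forall u, K u -> Cs_closure u) (K_compact : compact K)
    (xi : nat -> 'cV[R]_d -> R)
    (PsiD_K : smoothed_approximation [set PsiD u | u in K] xi)
    (xi_Cs : forall j, (Cs_norm s' Omega (xi j : _ -> R^o) < +oo)%E)
    (sigma : R -> R) (sigmaP : activation_assumption sigma s')
    (eps : R) (eps_gt0 : 0 < eps) :
  exists Psi : nno sigma d k k',
    [/\ (forall u, K u -> nno_defined Omega Psi u),
        (nnsup K (fun u => Cs_norm s' Omega
           (fun x => PsiD u x - nno_eval Omega Psi u x)%R) < eps%:E)%E,
        (exists L, nno_depth Psi = L.+1 /\
         exists J, (0 < J)%N /\
           (forall j, (j < J)%N -> exists m,
              {in Omega, nno_phi (nno_layers Psi L) m =1 xi j}) /\
           (forall j m, (j < J)%N ->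
              {in Omega, nno_phi (nno_layers Psi L) m =1 xi j} ->
              admissible_basis Omega (nno_psi (nno_layers Psi L) m))) &
        (exists l m, (l.+1 < nno_depth Psi)%N /\
           let eta1 := nno_psi (nno_layers Psi l) m in
           let eta2 := nno_phi (nno_layers Psi l) m in
           [/\ forall x, Omega x -> 0 <= eta1 x,
               admissible_basis Omega eta1 & admissible_basis Omega eta2])].
Proof.
have [np ss s0 _] := sigmaP.
have [B [f [fB [_ S1 S2 S3]]]] := PsiD_K.
(* each of the errors t1, ..., t4 below is at most eps / 5 *)
pose e5 := eps / 5; have e50 : 0 < e5 by rewrite divr_gt0.
have near0 : nbhs 0%E [set x : \bar R | (x < e5%:E)%E].
  apply: open_nbhs_nbhs; split; first exact: open_ereal_lt_ereal.
  by rewrite /= lte_fin.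
have [delta [delta0 Sdelta]] : exists delta : R, 0 < delta /\
    (nnsup [set PsiD u | u in K] (fun w => `|f delta w - w|%:E) < e5%:E)%E.
  have H : \forall delta \near (0 : R)^'+, 0 < delta /\
      (nnsup [set PsiD u | u in K] (fun w => `|f delta w - w|%:E) < e5%:E)%E.
    near=> t; split; first by near: t; exact: nbhs_right_gt.
    near: t; exact: S1 near0.
  exact: filter_ex H.
have [J [J0 SJ]] : exists J : nat, (0 < J)%N /\
    (nnsup [set PsiD u | u in K] (fun w => Cs_norm s' Omega (fun x => f delta w x -
      (\sum_(j < J) xi j x *: L2_inner B (fB delta w) (xi j))%R)%R) < e5%:E)%E.
  have H : \forall J \near \oo, (0 < J)%N /\
    (nnsup [set PsiD u | u in K] (fun w => Cs_norm s' Omega (fun x => f delta w x -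
      (\sum_(j < J) xi j x *: L2_inner B (fB delta w) (xi j))%R)%R) < e5%:E)%E.
    near=> t; split; first by near: t; exact: nbhs_infty_gt.
    near: t; exact: (S2 _ delta0) near0.
  exact: filter_ex H.
pose F (x : 'I_J * 'I_k') (u : Cs_space oOmega s 'cV[R]_k) : R :=
  L2_inner B (fB delta (PsiD u)) (xi x.1) x.2 0.
have cF x : {within K, continuous (F x)}.
  have cP := continuous_subspaceW K_sub PsiD_cont.
  apply/subspace_continuousP => u Ku.
  move/subspace_continuousP : cP => /(_ u Ku) cP.
  have c1 := continuous_comp (S3 delta x.1 delta0 (PsiD u))
    (@coord_continuous _ _ _ x.2 0 (L2_inner B (fB delta (PsiD u)) (xi x.1))).
  exact: (cvg_comp _ _ cP c1).
pose mm : R := #|{: multi_index d s'}|%:R; have mm0 : 0 <= mm by exact: ler0n.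
pose N := basis_norm s' Omega xi.
have N0 j : 0 <= N j := basis_norm_ge0 s' Omega xi j.
pose SN := \sum_(j < J) N j; have SN0 : 0 <= SN by exact: sumr_ge0.
pose D := SN * mm + 1; have D0 : 0 < D by rewrite ltr_wpDl// mulr_ge0.
pose eta := Num.min 1 (e5 / D).
have eta0 : 0 < eta by rewrite lt_min ltr01 divr_gt0.
have eta1 : eta <= 1 by rewrite ge_min lexx.
have etaD : eta * SN * mm <= e5.
  apply: (@le_trans _ _ (eta * D)); first by rewrite -mulrA ler_wpM2l ?(ltW eta0)// lerDl.
  by rewrite -ler_pdivlMr// ge_min lexx orbT.
have [a1 [b1 [c1 [e1 [p [psi [bias [W [bpsi FW]]]]]]]]] :=
  coefficient_approx bOmega ss np K_compact cF eta0.
set coef := coefficient sigma Omega a1 b1 c1 e1 psi bias W in FW.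
have /choice[Mx MxP] : forall x, exists M : R, 0 <= M /\ forall u, K u -> `|F x u| <= M.
  move=> x; have [M M0 FM] := compact_within_bounded K_compact (cF x).
  by exists M; split => //; exact: ltW.
(* a bound for the coefficients, hence for z and its derivatives, that is
   uniform in u and independent of the activation chosen afterwards *)
pose MF := \sum_x Mx x.
have FMF x u : K u -> `|F x u| <= MF.
  move=> Ku; rewrite (le_trans ((MxP x).2 u Ku))// /MF (bigD1 x)//= lerDl.
  by apply: sumr_ge0 => y _; exact: (MxP y).1.
have MF0 : 0 <= MF by apply: sumr_ge0 => x _; exact: (MxP x).1.
have coefM x u : K u -> `|coef u x| <= MF + 1.
  move=> Ku; rewrite -(subKr (F x u) (coef u x)) (le_trans (ler_normB _ _))//.
  by rewrite lerD ?FMF// (le_trans (FW x u Ku)).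
pose Bz := (MF + 1) * SN; have Bz0 : 0 <= Bz by rewrite mulr_ge0// addr_ge0.
pose eta2 := e5 / (mm + 1).
have eta20 : 0 < eta2 by rewrite divr_gt0// ltr_wpDl.
have eta2mm : eta2 * mm <= e5.
  by rewrite /eta2 mulrAC ler_pdivrMr ?ltr_wpDl// ler_wpM2l ?(ltW e50)// lerDl.
have [a [b [c [e]]]] := double_near_identity ss np s' oOmega Bz0 eta20.
set g := affine_act sigma a b c e => gP.
exists (operator sigma Omega a1 b1 c1 e1 a b c e psi bias W xi); split.
- by move=> u _; apply: operator_defined => //; exact: Cs_space_bounded_continuous.
- apply: (@le_lt_trans _ _ (4 * e5)%:E); last first.
    by rewrite lte_fin /e5; lra.
  apply: nnsup_le => [|u Ku]; first by rewrite lee_fin mulr_ge0// ltW.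
  pose w := PsiD u; have Kw : [set PsiD u | u in K] w by exists u.
  pose z (l : 'I_k') := combination xi (fun j : 'I_J => coef u (j, l)).
  (* errors of the smoothing, of the truncation to J terms, of the coefficients
     and of the last activation and projection *)
  pose t1 : 'cV[R]_d -> 'cV[R]_k' := fun x => w x - f delta w x.
  pose t2 : 'cV[R]_d -> 'cV[R]_k' := fun x => f delta w x -
    \sum_(j < J) xi j x *: L2_inner B (fB delta w) (xi j).
  pose t3 : 'cV[R]_d -> 'cV[R]_k' := fun x => \col_l
    combination xi (fun j : 'I_J => F (j, l) u - coef u (j, l)) x.
  pose t4 : 'cV[R]_d -> 'cV[R]_k' := fun x => \col_l (z l x - g (g (z l x))).
  have n1 : (Cs_norm s' Omega t1 <= e5%:E)%E.
    have -> : Cs_norm s' Omega t1 = `|w - f delta w|%:E.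
      by rewrite Cs_space_normE fineK ?Cs_space_fin.
    rewrite distrC; apply: le_trans (ltW Sdelta).
    exact: (nnsup_ub (fun w => `|f delta w - w|%:E)).
  have n2 : (Cs_norm s' Omega t2 <= e5%:E)%E.
    apply: le_trans (ltW SJ).
    exact: (nnsup_ub (fun w => Cs_norm s' Omega (fun x => f delta w x -
      (\sum_(j < J) xi j x *: L2_inner B (fB delta w) (xi j))%R)%R)).
  have t3E l : (fun x => t3 x l 0 : R^o) =
      combination xi (fun j : 'I_J => F (j, l) u - coef u (j, l)).
    by apply/funext => x; rewrite mxE.
  have n3 : (Cs_norm s' Omega t3 <= e5%:E)%E.
    have M0 : 0 <= eta * SN by rewrite mulr_ge0// ltW.
    have H l := combination_le oOmega xi_Cs (fun j : 'I_J => F (j, l) u - coef u (j, l)).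
    apply: (le_trans (Cs_norm_col_le oOmega M0 _ _)).
    + by move=> l; rewrite t3E; exact: (H l).1.
    + move=> l alpha x oa Ox; rewrite t3E.
      rewrite (le_trans ((H l).2 alpha _ oa (subseq_refl _) x Ox))//.
      rewrite /SN mulr_sumr; apply: ler_sum => j _.
      by rewrite ler_wpM2r ?N0// FW.
    by rewrite lee_fin -mulr_natr.
  have t4E l : (fun x => t4 x l 0 : R^o) = (fun x => z l x - g (g (z l x)) : R^o).
    by apply/funext => x; rewrite mxE.
  have n4 : (Cs_norm s' Omega t4 <= e5%:E)%E.
    have Hz l := combination_le oOmega xi_Cs (fun j : 'I_J => coef u (j, l)).
    apply: (le_trans (Cs_norm_col_le oOmega (ltW eta20) _ _)).
    + by move=> l; rewrite t4E; exact: (gP _ (Hz l).1).1.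
    + move=> l alpha x oa Ox; rewrite t4E.
      apply: ((gP _ (Hz l).1).2 _ (order_leP oa)) => // l' y ll' Oy.
      rewrite (le_trans ((Hz l).2 alpha l' oa ll' y Oy))//.
      rewrite /Bz /SN mulr_sumr; apply: ler_sum => j _.
      by rewrite ler_wpM2r ?N0// coefM.
    by rewrite lee_fin -mulr_natr.
  rewrite (_ : (fun x => _) = (t1 + t2) + (t3 + t4)); last first.
    apply/funext => x; rewrite operatorE// !fctE /t1 /t2 -/coef -/g.
    rewrite (_ : t3 x + t4 x = \sum_(j < J) xi j x *: L2_inner B (fB delta w) (xi j) -
       \col_l g (g (\sum_(j < J) xi j x * coef u (j, l)))).
      by rewrite [RHS]addrA; congr (_ - _); rewrite addrA !subrK.
    apply/colP => l; rewrite !mxE /z /combination addrA; congr (_ - _).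
    rewrite -big_split summxE/=; apply: eq_bigr => j _.
    by rewrite -mulrDr subrK [RHS]mxE.
  have lty (v : \bar R) : (v <= e5%:E)%E -> (v < +oo)%E.
    by move=> /le_lt_trans; apply; exact: ltry.
  have n12 := le_trans (Cs_norm_tri oOmega (lty _ n1) (lty _ n2)) (leeD n1 n2).
  have n34 := le_trans (Cs_norm_tri oOmega (lty _ n3) (lty _ n4)) (leeD n3 n4).
  have lty2 (v : \bar R) : (v <= e5%:E + e5%:E)%E -> (v < +oo)%E.
    by move=> /le_lt_trans; apply; rewrite -EFinD ltry.
  apply: (le_trans (Cs_norm_tri oOmega (lty2 _ n12) (lty2 _ n34))).
  apply: (le_trans (leeD n12 n34)); rewrite -!EFinD lee_fin; lra.
- exact: operator_output_basis.
- exact: operator_earlier_basis.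
Unshelve. all: by end_near. Qed.
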